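(* For every $s\in(0,1)$ there exist positive numbers $\varphi_{0},c,g$ such that for all $\varphi$ with $|\varphi|\le\varphi_{0}$, all $\mu,\nu\in\mathbb Z^{2}$ and all $z\in\mathbb C\setminus\mathbb T$, \[\mathbb E\big(|\langle e_{\mu},R_\omega(\varphi,z)e_{\nu}\rangle|^{s}\big)\le c\,e^{-g|\mu-\nu|}.\]
   Context: Let $\{e_{\mu}\}_{\mu\in\mathbb Z^{2}}$ be the standard basis of $\ell^{2}(\mathbb Z^{2})$, $|\mu|$ the Euclidean norm, and $\mathbb T=\{z\in\mathbb C:|z|=1\}$. Let $\Omega=\mathbb T^{\mathbb Z^{2}}$ with the product $\sigma$-algebra and probability $\mathbb P=\bigotimes_{\mu\in\mathbb Z^{2}}d\ell$, $d\ell$ normalized Lebesgue measure on $\mathbb T$; $\mathbb E$ is expectation. $D_{\omega}e_{\mu}=\omega_{\mu}e_{\mu}$. $S_{\circlearrowleft}$ is the unitary permuting cyclically $e_{(2j,2k)}\mapsto e_{(2j+1,2k)}\mapsto e_{(2j+1,2k+1)}\mapsto e_{(2j,2k+1)}\mapsto e_{(2j,2k)}$ for all $j,k\in\mathbb Z$; $S_{\circlearrowright}$ is the unitary permuting cyclically $e_{(2j,2k)}\mapsto e_{(2j,2k-1)}\mapsto e_{(2j-1,2k-1)}\mapsto e_{(2j-1,2k)}\mapsto e_{(2j,2k)}$ for all $j,k$. $S(\varphi)=\cos\varphi\,S_{\circlearrowleft}+i\sin\varphi\,S_{\circlearrowright}$, $U_\omega(\varphi)=D_\omega S(\varphi)$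 on $\ell^2(\mathbb Z^2)$, and $R_\omega(\varphi,z)=(U_\omega(\varphi)-z)^{-1}$ for $z\in\mathbb C\setminus\mathbb T$. *)

(* Defs.v *)
From HB Require Import structures.
From mathcomp Require Import all_boot all_order all_algebra.
From mathcomp Require Import all_classical all_reals all_analysis.
From mathcomp Require Import complex.

Set Implicit Arguments.
Unset Strict Implicit.
Unset Printing Implicit Defensive.

Import Order.TTheory GRing.Theory Num.Theory.
Local Open Scope ring_scope.
Local Open Scope classical_set_scope.

Section Model.
Variable R : realType.

Definition site := (int * int)%type.

Definition circle := {z : R[i] | Normc.normc z == 1}.

Lemma one_in_circle : Normc.normc (1 : R[i]) == 1.
Proof. by rewrite Normc.normc1. Qed.

HB.instance Definition _ := [Choice of circle by <:].
HB.instance Definition _ := isPointed.Build circle (exist _ 1 one_in_circle).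

Definition expi2pi (t : R) : R[i] :=
  Complex (cos (2 * pi * t)) (sin (2 * pi * t)).

Definition circle_set (B : set R) : set circle :=
  [set z | exists2 t, (B `&` `[0%R, 1%R[) t & val z = expi2pi t].

(* normalized Lebesgue measure on T of circle_set B is lebesgue (B /\ [0,1)) *)

Definition cyl_gen : set (set (site -> circle)) :=
  [set A | exists (k : site) (B : set R), measurable B /\
           A = [set w | circle_set B (w k)]].

Local Notation Omega := (g_sigma_algebraType cyl_gen).

Definition is_product_uniform (P : probability Omega R) : Prop :=
  forall (s : seq site) (B : site -> set R),
    uniq s -> (forall k, measurable (B k)) ->
    P [set w : Omega | forall k, k \in s -> circle_set (B k) (w k)] =
    (\prod_(k <- s) lebesgue_measure (B k `&` `[0%R, 1%R[))%E.

Definition evenz (a : int) : bool := (2 %| a)%Z.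

(* sigma_L : the anticlockwise cyclic permutation of S_circlearrowleft,
   (2j,2k) -> (2j+1,2k) -> (2j+1,2k+1) -> (2j,2k+1) -> (2j,2k) *)
Definition sigL (m : site) : site :=
  let: (a, b) := m in
  match evenz a, evenz b with
  | true, true => (a + 1, b)
  | false, true => (a, b + 1)
  | false, false => (a - 1, b)
  | true, false => (a, b - 1)
  end%R.

Definition sigL_inv (m : site) : site :=
  let: (a, b) := m in
  match evenz a, evenz b with
  | true, true => (a, b + 1)
  | false, true => (a - 1, b)
  | false, false => (a, b - 1)
  | true, false => (a + 1, b)
  end%R.

(* sigma_R : the permutation of S_circlearrowright,
   (2j,2k) -> (2j,2k-1) -> (2j-1,2k-1) -> (2j-1,2k) -> (2j,2k) *)
Definition sigR (m : site) : site :=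
  let: (a, b) := m in
  match evenz a, evenz b with
  | true, true => (a, b - 1)
  | true, false => (a - 1, b)
  | false, false => (a, b + 1)
  | false, true => (a + 1, b)
  end%R.

Definition sigR_inv (m : site) : site :=
  let: (a, b) := m in
  match evenz a, evenz b with
  | true, true => (a - 1, b)
  | true, false => (a, b + 1)
  | false, false => (a + 1, b)
  | false, true => (a, b - 1)
  end%R.

Definition l2 (x : site -> R[i]) : Prop :=
  exists M : R, forall s : seq site, uniq s ->
    \sum_(k <- s) Normc.normc (x k) ^+ 2 <= M.

(* S e_m = e_(sig m), i.e. (S x)(k) = x (sig^-1 k) *)
Definition SL (x : site -> R[i]) (k : site) : R[i] := x (sigL_inv k).
Definition SR (x : site -> R[i]) (k : site) : R[i] := x (sigR_inv k).

Definition Uop (w : site -> circle) (phi : R) (x : site -> R[i]) (k : site)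
  : R[i] :=
  val (w k) * ((cos phi)%:C%C * SL x k + (Complex 0 1) * (sin phi)%:C%C * SR x k).

(* <e_mu, R_w(phi,z) e_nu> : the mu-th entry of the unique l^2 vector y with
   (U_w(phi) - z) y = e_nu *)
Definition resolvent_entry (w : site -> circle) (phi : R) (z : R[i])
  (mu nu : site) : R[i] :=
  xget 0 [set c | exists y : site -> R[i],
     [/\ l2 y, (forall k, Uop w phi y k - z * y k = (k == nu)%:R) & y mu = c]].

Definition dist2 (mu nu : site) : R :=
  Num.sqrt (((mu.1 - nu.1)%:~R) ^+ 2 + ((mu.2 - nu.2)%:~R) ^+ 2).



End Model.

Arguments dist2 {R}.
Notation Omega R := (g_sigma_algebraType (@cyl_gen R)).

(* Main.v *)
(* Aizenman-Molchanov scheme at large disorder. Going once around the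
   four-cycle of S_L through mu, the equation (U - z) y = e_nu becomes
   (z^4 - cos^4 w0 w1 w2 w3) y(mu) = terms of size |sin phi| in the values of y
   at four nearby sites, plus a source supported near nu. Both this factor and
   1 / |y(mu)| are moduli of affine functions of the phase w(mu), the latter
   because changing w(mu) is a rank one perturbation; an affine function is
   small only on a small set of phases, so the factor can be taken out of the
   fractional moment at the price of a constant independent of z and phi. The
   resulting inequality E|y(mu)|^s <= C |sin phi|^s sum E|y(.)|^s + source is a
   contraction for small phi; iterating it from the deterministic bound on the
   resolvent valid for |z| <> 1 gives the exponential decay. *)
Require Import Defs.
From HB Require Import structures.
From mathcomp Require Import all_boot all_order all_algebra.
From mathcomp Require Import all_classical all_reals all_analysis.
From mathcomp Require Import complex.
From mathcomp Require Import measurable_realfun ring lra zify.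
Set Implicit Arguments.
Unset Strict Implicit.
Unset Printing Implicit Defensive.

Import Defs.
Import Order.TTheory GRing.Theory Num.Theory.
Import numFieldNormedType.Exports.
Local Open Scope ring_scope.
Local Open Scope classical_set_scope.

(** * The two site permutations *)

(** A single line of the equation links y(mu) to y([sigL_inv mu]) with a coefficient of modulus |cos
    phi|, which is not small; only after the cycle closes does every remaining coupling carry sin
    phi. The price is a factor without a lower bound uniform in z and in the phases, and it depends
    on the same phase w(mu) as y(mu), so independence cannot separate the two. With the other phases
    frozen, however, |y(mu)| = gamma / |a + b w(mu)| where gamma does not depend on w(mu) and
    cancels from both sides; what is left compares two affine functions of one uniform variable.
    Dividing each by its larger coefficient makes the sublevel estimates, hence the constants,
    independent of z. The deterministic bound on the resolvent blows up as |z| tends to 1. It serves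
    only for finiteness, so that half of an integral can be absorbed, and as the start of an
    iteration that halves it at each step. It comes from Neumann series, which also make the entries
    measurable. *)

Lemma evenzD1 (a : int) : evenz (a + 1) = ~~ evenz a.
Proof. by rewrite /evenz; lia. Qed.

Lemma evenzB1 (a : int) : evenz (a - 1) = ~~ evenz a.
Proof. by rewrite /evenz; lia. Qed.

Ltac site_cases :=
  let a := fresh "a" in let b := fresh "b" in intros [a b];
  rewrite /sigL /sigL_inv /sigR /sigR_inv;
  let ea := fresh "ea" in let eb := fresh "eb" in
  destruct (evenz a) eqn:ea; destruct (evenz b) eqn:eb;
  do 4 rewrite ?evenzD1 ?evenzB1 ?addrK ?subrK ?ea ?eb //=.

Lemma sigLK : cancel sigL sigL_inv. Proof. by site_cases. Qed.
Lemma sigL_invK : cancel sigL_inv sigL. Proof. by site_cases. Qed.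
Lemma sigRK : cancel sigR sigR_inv. Proof. by site_cases. Qed.
Lemma sigR_invK : cancel sigR_inv sigR. Proof. by site_cases. Qed.

(** This identity and the next one say that [sigL \o sigR_inv] and [sigL_inv \o sigR] are
    involutions. They cancel the cross terms, of size cos phi sin phi, in the products of S(phi)
    with its adjoint, and thus make S(phi) unitary. *)
Lemma sigL_sigR_inv (k : site) : sigL (sigR_inv k) = sigR (sigL_inv k).
Proof. by move: k; site_cases. Qed.

Lemma sigL_inv_sigR (k : site) : sigL_inv (sigR k) = sigR_inv (sigL k).
Proof. by move: k; site_cases. Qed.

Lemma sigL_inv4 (k : site) : sigL_inv (sigL_inv (sigL_inv (sigL_inv k))) = k.
Proof. by move: k; site_cases. Qed.

(** Distances are counted in lattice hops, where each application of a site permutation costs one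
    unit. Decay in this distance is stronger than decay in the Euclidean one. *)
Definition l1dist (m n : site) : nat := (`|m.1 - n.1| + `|m.2 - n.2|)%N.

Lemma l1dist_triangle (l m n : site) :
  (l1dist l n <= l1dist l m + l1dist m n)%N.
Proof. by rewrite /l1dist; lia. Qed.

Lemma l1dist0 (m : site) : l1dist m m = 0%N.
Proof. by rewrite /l1dist; lia. Qed.

Lemma l1dist_sigL_inv (k : site) : (l1dist k (sigL_inv k) <= 1)%N.
Proof. by move: k; site_cases; rewrite /l1dist /=; lia. Qed.

Lemma l1dist_sigR_inv (k : site) : (l1dist k (sigR_inv k) <= 1)%N.
Proof. by move: k; site_cases; rewrite /l1dist /=; lia. Qed.

Lemma sigL_inv_neq (k : site) :
  [/\ sigL_inv k != k, sigL_inv (sigL_inv k) != k &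
      sigL_inv (sigL_inv (sigL_inv k)) != k].
Proof. by move: k; site_cases; rewrite !xpair_eqE; split; lia. Qed.

Lemma dist2_le_l1dist (R : realType) (m n : site) :
  dist2 m n <= (l1dist m n)%:R :> R.
Proof.
rewrite /dist2 /l1dist -(ler_pXn2r (n := 2)) ?nnegrE ?sqrtr_ge0//.
rewrite sqr_sqrtr ?addr_ge0 ?sqr_ge0// natrD !natr_absz !intr_norm sqrrD.
by rewrite !real_normK ?num_real// addrAC lerDl mulrn_wge0 ?mulr_ge0.
Qed.

(** * The modulus of complex numbers *)

Section complex_norm.
Variable R : realType.
Implicit Types x y u v : R[i].
Local Notation normc := (@Normc.normc R).

Lemma normc_ge0 x : 0 <= normc x.
Proof. by case: x => a b; exact: sqrtr_ge0. Qed.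

Lemma sqr_normc x : normc x ^+ 2 = complex.Re x ^+ 2 + complex.Im x ^+ 2.
Proof. by case: x => a b; rewrite /= sqr_sqrtr ?addr_ge0 ?sqr_ge0. Qed.

Lemma normcX x n : normc (x ^+ n) = normc x ^+ n.
Proof.
elim: n => [|n IHn]; first by rewrite !expr0 Normc.normc1.
by rewrite !exprS Normc.normcM IHn.
Qed.

Lemma normc_real (a : R) : normc a%:C%C = `|a|.
Proof. by rewrite /= expr0n addr0 sqrtr_sqr. Qed.

Lemma normc_i : normc (Complex 0 1) = 1.
Proof. by rewrite /= expr0n expr1n add0r sqrtr1. Qed.

Lemma Re_le_normc x : `|complex.Re x| <= normc x.
Proof.
rewrite -(ler_pXn2r (n := 2)) ?nnegrE ?normc_ge0// sqr_normc.
by rewrite real_normK ?num_real// lerDl sqr_ge0.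
Qed.

Lemma Im_le_normc x : `|complex.Im x| <= normc x.
Proof.
rewrite -(ler_pXn2r (n := 2)) ?nnegrE ?normc_ge0// sqr_normc.
by rewrite real_normK ?num_real// lerDr sqr_ge0.
Qed.

Lemma normcD_le x y : normc (x + y) <= normc x + normc y.
Proof. exact: le_normcD. Qed.

Lemma normc_opp x : normc (- x) = normc x.
Proof. by case: x => a b /=; rewrite !sqrrN. Qed.

Lemma normcB_sym x y : normc (x - y) = normc (y - x).
Proof. by rewrite -opprB normc_opp. Qed.

Lemma normcB_ge x y : normc x - normc y <= normc (x - y).
Proof. by rewrite lerBlDr -{1}(subrK y x) normcD_le. Qed.

Lemma normc_eq0 x : (normc x == 0) = (x == 0).
Proof.
by apply/eqP/eqP => [/Normc.eq0_normc//|->]; exact: Normc.normc0.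
Qed.

Lemma mulc_conjc x : normc x = 1 -> x * conjc x = 1.
Proof.
move=> x1; have := sqr_normc x; rewrite x1 expr1n => e.
by case: x x1 e => a b _ /= e; apply/eqP; rewrite eq_complex /=; apply/andP;
  split; apply/eqP; [rewrite mulrN opprK -!expr2|ring].
Qed.

Lemma normc_conjc x : normc (conjc x) = normc x.
Proof. by case: x => a b /=; rewrite sqrrN. Qed.

(** Convexity of the square at u / (1 - |a|) and v, with weights 1 - |a| and |a|. Summed over sites
    it replaces Minkowski's inequality and still gives the sharp bound for a Neumann series. *)
Lemma sqr_normc_convex (a u v : R[i]) : normc a < 1 ->
  normc (u + a * v) ^+ 2 <=
  normc u ^+ 2 / (1 - normc a) + normc a * normc v ^+ 2.
Proof.
set t := normc a => t1; have t0 : 0 <= t by exact: normc_ge0.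
have p0 := normc_ge0 u; have q0 := normc_ge0 v.
apply: (@le_trans _ _ ((normc u + t * normc v) ^+ 2)).
  rewrite ler_pXn2r ?nnegrE ?normc_ge0 ?addr_ge0 ?mulr_ge0//.
  by rewrite /t -Normc.normcM normcD_le.
rewrite -subr_ge0.
rewrite (_ : _ - _ = t * (normc u - (1 - t) * normc v) ^+ 2 / (1 - t)).
  by rewrite divr_ge0 ?subr_ge0 ?(ltW t1)// mulr_ge0// sqr_ge0.
by field; rewrite subr_eq0 gt_eqF.
Qed.

End complex_norm.

(** * Contractions of l^2 *)

(** [M] bounds the square of the norm. Finite sums suffice, and a bound of this form passes to
    coordinatewise limits. *)
Definition l2le {R : realType} (x : site -> R[i]) (M : R) : Prop :=
  forall s : seq site, uniq s ->
    \sum_(k <- s) Normc.normc (x k) ^+ 2 <= M.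

Section l2.
Variable R : realType.
Implicit Types (x y b : site -> R[i]) (M : R).
Local Notation normc := (@Normc.normc R).

Lemma l2le_l2 x M : l2le x M -> l2 x.
Proof. by exists M. Qed.

Lemma l2le_pt x M k : l2le x M -> normc (x k) ^+ 2 <= M.
Proof. by move/(_ [:: k] isT); rewrite big_seq1. Qed.

Lemma l2le_normc x M k : l2le x M -> normc (x k) <= Num.sqrt M.
Proof.
move=> /(l2le_pt k) le_M.
by rewrite -(ger0_norm (normc_ge0 (x k))) -sqrtr_sqr ler_wsqrtr.
Qed.

Lemma l2le_scale x M (a : R[i]) :
  l2le x M -> l2le (fun k => a * x k) (normc a ^+ 2 * M).
Proof.
move=> xM s us; under eq_bigr do rewrite Normc.normcM exprMn.
by rewrite -mulr_sumr ler_wpM2l ?sqr_ge0// xM.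
Qed.

Lemma l2le_unimodular x M (w : site -> R[i]) :
  (forall k, normc (w k) = 1) -> l2le x M -> l2le (fun k => w k * x k) M.
Proof.
by move=> w1 xM s us; under eq_bigr do rewrite Normc.normcM w1 mul1r; exact: xM.
Qed.

Lemma l2le_add x y M N :
  l2le x M -> l2le y N -> l2le (fun k => x k + y k) (2 * (M + N)).
Proof.
move=> xM yN s us.
rewrite mulrDr (le_trans _ (lerD (ler_wpM2l _ (xM s us))
  (ler_wpM2l _ (yN s us))))// !mulr_sumr -big_split/= ler_sum// => k _.
apply: (@le_trans _ _ ((normc (x k) + normc (y k)) ^+ 2)).
  by rewrite ler_pXn2r ?nnegrE ?addr_ge0 ?normc_ge0 ?normcD_le.
have := sqr_ge0 (normc (x k) - normc (y k)); rewrite sqrrB sqrrD; lra.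
Qed.

Lemma l2le_delta (nu : site) : l2le (fun k => (k == nu)%:R : R[i]) 1.
Proof.
move=> s us.
rewrite (eq_bigr (fun k => (k == nu)%:R : R)) => [|k _]; last first.
  by case: (k == nu); rewrite ?Normc.normc1 ?Normc.normc0 ?expr1n ?expr0n.
have [ns|ns] := boolP (nu \in s).
  rewrite (bigD1_seq nu)//= eqxx big1 ?addr0// => k /negbTE ->//.
by rewrite big_seq big1 ?ler01// => k ks; case: eqP => // kn; move: ns; rewrite -kn ks.
Qed.

Lemma l2le_convex b y B M (a : R[i]) : normc a < 1 -> l2le b B -> l2le y M ->
  l2le (fun k => b k + a * y k) (B / (1 - normc a) + normc a * M).
Proof.
move=> a1 bB yM s us.
rewrite (le_trans (ler_sum _ (fun k _ => sqr_normc_convex (b k) (y k) a1)))//.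
rewrite big_split/= -mulr_suml -mulr_sumr lerD//.
  by rewrite ler_wpM2r ?bB// invr_ge0 subr_ge0 ltW.
by rewrite ler_wpM2l ?normc_ge0 ?yM.
Qed.

Definition rot (p q : site -> site) (phi : R) x (k : site) : R[i] :=
  (cos phi)%:C%C * x (p k) + Complex 0 1 * (sin phi)%:C%C * x (q k).

Lemma sqr_normc_rot (phi : R) (u v : R[i]) :
  normc ((cos phi)%:C%C * u + Complex 0 1 * (sin phi)%:C%C * v) ^+ 2 +
  normc ((cos phi)%:C%C * v + Complex 0 1 * (sin phi)%:C%C * u) ^+ 2 =
  normc u ^+ 2 + normc v ^+ 2.
Proof.
rewrite !sqr_normc; case: u v => [a b] [c d] /=.
have cs := cos2Dsin2 phi.
transitivity ((cos phi ^+ 2 + sin phi ^+ 2) * (a ^+ 2 + b ^+ 2 + c ^+ 2 + d ^+ 2)).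
  by ring.
by rewrite cs; ring.
Qed.

(* [q \o p^-1] is an involution, so the sites split into pairs on which [rot]
   acts by a unitary 2x2 matrix. *)
Lemma l2le_rot (p q : site -> site) (phi : R) x M :
  injective p -> (exists2 tau, involutive tau & p \o tau =1 q) ->
  l2le x M -> l2le (rot p q phi x) M.
Proof.
move=> injp [tau tauK ptau] xM s us.
have qtau k : q (tau k) = p k by rewrite -ptau /= tauK.
(* Closing the list under [tau] completes every pair [k], [tau k]. *)
pose s' := undup (s ++ map tau s); pose F k := normc (rot p q phi x k) ^+ 2.
have us' : uniq s' by exact: undup_uniq.
have taus' k : (tau k \in s') = (k \in s').
  rewrite !mem_undup !mem_cat (mem_map (inv_inj tauK)) orbC; congr orb.
  by rewrite -(mem_map (inv_inj tauK)) tauK.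
have FtauF : \sum_(k <- s') F k = \sum_(k <- s') F (tau k).
  rewrite -(big_map tau xpredT F); apply: perm_big; apply: uniq_perm => //.
    by rewrite map_inj_uniq//; exact: inv_inj.
  by move=> k; rewrite -{2}(tauK k) (mem_map (inv_inj tauK)) taus'.
have Epq : \sum_(k <- s') normc (x (q k)) ^+ 2 =
           \sum_(k <- s') normc (x (p k)) ^+ 2.
  rewrite -(eq_bigr _ (fun k _ => congr1 (fun l => normc (x l) ^+ 2) (ptau k))).
  rewrite /= -(big_map tau xpredT (fun k => normc (x (p k)) ^+ 2)).
  apply: perm_big; apply: uniq_perm => //.
    by rewrite map_inj_uniq//; exact: inv_inj.
  by move=> k; rewrite -{1}(tauK k) (mem_map (inv_inj tauK)) taus'.
(* Doubling both sides allows each site to be added to its partner, and the 2x2 unitarity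
   [sqr_normc_rot] applies term by term. *)
have two : 2 * \sum_(k <- s') F k = 2 * \sum_(k <- s') normc (x (p k)) ^+ 2.
  rewrite !mulr_natl !mulr2n {2}FtauF -{2}Epq -!big_split/=.
  apply: eq_bigr => k _; rewrite /F /rot qtau.
  by rewrite (_ : p (tau k) = q k) ?sqr_normc_rot//; exact: ptau.
have le_s' : \sum_(k <- s) F k <= \sum_(k <- s') F k.
  rewrite [leRHS](bigID (mem s))/= -[X in _ <= X + _]big_filter.

  have /(perm_big _) -> : perm_eq [seq k <- s' | k \in s] s.
    apply: uniq_perm; rewrite ?filter_uniq// => k.
    by rewrite mem_filter mem_undup mem_cat; case: (k \in s).
  by rewrite lerDl sumr_ge0// => k _; exact: sqr_ge0.
apply: (le_trans le_s'); rewrite -(ler_pM2l (ltr0n _ 2)) two ler_pM2l ?ltr0n//.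
by rewrite -(big_map p xpredT (fun k => normc (x k) ^+ 2)) xM ?map_inj_uniq.
Qed.

End l2.

(** * Neumann series with coordinatewise limits *)

Section iteration.
Variable R : realType.
Local Notation normc := (@Normc.normc R).

Lemma cvgn_geometric_increments (u : nat -> R) (C r : R) : 0 <= r < 1 ->
  (forall n, `|u n.+1 - u n| <= C * r ^+ n) -> cvgn u.
Proof.
move=> /andP[r0 r1] uC.
have : cvgn (series (telescope u)).
  apply: normed_cvg; apply: (@series_le_cvg _ _ (geometric C r)).
  - by move=> n; exact: normr_ge0.
  - by move=> n; exact: le_trans (normr_ge0 _) (uC n).
  - exact: uC.
  - by apply: is_cvg_geometric_series; rewrite ger0_norm.
move=> cvt; rewrite (_ : u = fun n => u 0%N + series (telescope u) n); last first.
  by apply/funext => n; exact: eq_sum_telescope.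
by apply: is_cvgD => //; exact: is_cvg_cst.
Qed.

Lemma ReB (x y : R[i]) : complex.Re (x - y) = complex.Re x - complex.Re y.
Proof. by case: x y => [? ?] []. Qed.

Lemma ImB (x y : R[i]) : complex.Im (x - y) = complex.Im x - complex.Im y.
Proof. by case: x y => [? ?] []. Qed.

Definition cvgC (u : nat -> R[i]) (l : R[i]) : Prop :=
  (fun n => complex.Re (u n)) @ \oo --> complex.Re l /\
  (fun n => complex.Im (u n)) @ \oo --> complex.Im l.

Lemma cvgC_cst (a : R[i]) : cvgC (fun=> a) a.
Proof. by split; exact: cvg_cst. Qed.

Lemma cvgCD u v l m : cvgC u l -> cvgC v m -> cvgC (fun n => u n + v n) (l + m).
Proof.
move=> [u1 u2] [v1 v2]; split.
  under eq_fun do rewrite raddfD; rewrite raddfD; exact: cvgD.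
by under eq_fun do rewrite raddfD; rewrite raddfD; exact: cvgD.
Qed.

Lemma cvgCMr (a : R[i]) u l : cvgC u l -> cvgC (fun n => a * u n) (a * l).
Proof.
case: a => a b [u1 u2]; split.
  under eq_fun => n.
    rewrite (_ : complex.Re _ = a * complex.Re (u n) - b * complex.Im (u n));
      last by case: (u n).
    over.
  rewrite (_ : complex.Re _ = a * complex.Re l - b * complex.Im l);
    last by case: l {u1 u2}.
  by apply: cvgB; apply: cvgMr.
under eq_fun => n.
  rewrite (_ : complex.Im _ = a * complex.Im (u n) + b * complex.Re (u n));
    last by case: (u n).
  over.
rewrite (_ : complex.Im _ = a * complex.Im l + b * complex.Re l);
  last by case: l {u1 u2}.
by apply: cvgD; apply: cvgMr.
Qed.

Lemma cvgC_unique u l m : cvgC u l -> cvgC u m -> l = m.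
Proof.
move=> [u1 u2] [v1 v2]; apply/eqP; rewrite eq_complex; apply/andP; split; apply/eqP.
  exact: (cvg_unique _ u1 v1).
exact: (cvg_unique _ u2 v2).
Qed.

Lemma cvgC_shift u l : cvgC u l -> cvgC (fun n => u n.+1) l.
Proof.
move=> [u1 u2]; split.
  by move: u1; rewrite -(cvg_shiftS (fun n => complex.Re (u n))).
by move: u2; rewrite -(cvg_shiftS (fun n => complex.Im (u n))).
Qed.

Lemma cvgC_normc2 u l : cvgC u l ->
  (fun n => normc (u n) ^+ 2) @ \oo --> normc l ^+ 2.
Proof.
move=> [u1 u2]; under eq_fun do rewrite sqr_normc; rewrite sqr_normc.
by apply: cvgD; rewrite expr2; under eq_fun do rewrite expr2; exact: cvgM.
Qed.

Lemma l2le_cvgC (x : nat -> site -> R[i]) (y : site -> R[i]) (M : R) :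
  (forall n, l2le (x n) M) -> (forall k, cvgC (fun n => x n k) (y k)) ->
  l2le y M.
Proof.
move=> xM xy s us.
have cv : (fun n => \sum_(k <- s) normc (x n k) ^+ 2) @ \oo -->
    \sum_(k <- s) normc (y k) ^+ 2.
  elim: s {us} => [|k s IHs].
    by rewrite big_nil; under eq_fun do rewrite big_nil; exact: cvg_cst.
  rewrite big_cons; under eq_fun do rewrite big_cons.
  by apply: cvgD => //; exact: cvgC_normc2.
rewrite -(cvg_lim _ cv)//; apply: limr_le; first by apply/cvg_ex; eexists; exact: cv.
by apply: nearW => n; exact: xM.
Qed.

Section fixpoint.
Variables (p q : site -> site) (A B : site -> R[i]).
Let V (x : site -> R[i]) (k : site) : R[i] := A k * x (p k) + B k * x (q k).
Hypothesis Vcontr : forall x M, l2le x M -> l2le (V x) M.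
Variables (a : R[i]) (b : site -> R[i]).
Hypothesis a1 : normc a < 1.
Hypothesis b1 : l2le b 1.

(** Partial sums of the Neumann series of y = b + a V y. Both U and its inverse have two entries per
    row, so this one shape of V serves inside and outside the unit circle. *)
Definition neumann : nat -> site -> R[i] :=
  fix f n := if n is n'.+1 then fun k => b k + a * (A k * f n' (p k) + B k * f n' (q k))
             else fun=> 0.

Let t := normc a.
Let t0 : 0 <= t. Proof. exact: normc_ge0. Qed.

(** The value (1 - t)^-2 is the fixed point of M |-> 1 / (1 - t) + t M, the map by which
    [l2le_convex] changes the bound at each step. *)
Lemma neumann_l2 n : l2le (neumann n) ((1 - t) ^- 2).
Proof.
have t1' : 0 < 1 - t by rewrite subr_gt0.
elim: n => [|n IHn] /=.
  move=> s _; rewrite big1 ?invr_ge0 ?sqr_ge0// => k _.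
  by rewrite Normc.normc0 expr0n.
have /= := l2le_convex a1 b1 (Vcontr IHn).
rewrite -/t (_ : _ + _ = (1 - t) ^- 2)//.
by field; rewrite gt_eqF.
Qed.

Lemma neumann_incr n : l2le (fun k => neumann n.+1 k - neumann n k) ((t ^+ 2) ^+ n).
Proof.
elim: n => [|n IHn].
  move=> s us; rewrite expr0.
  by under eq_bigr do rewrite /= !mulr0 addr0 mulr0 addr0 subr0; exact: b1.
rewrite exprS; have := l2le_scale a (Vcontr IHn).
move=> h s us; rewrite (le_trans _ (h s us))// le_eqVlt; apply/orP; left; apply/eqP.
by apply: eq_bigr => k _; congr (normc _ ^+ 2); rewrite /V /=; ring.
Qed.

Lemma neumann_cvg (k : site) : exists l, cvgC (fun n => neumann n k) l.
Proof.
have incr n : normc (neumann n.+1 k - neumann n k) <= 1 * t ^+ n.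
  rewrite mul1r -(ler_pXn2r (n := 2)) ?nnegrE ?normc_ge0 ?exprn_ge0//.
  by rewrite -exprM mulnC exprM; exact: (l2le_pt k (neumann_incr n)).
have t01 : 0 <= t < 1 by rewrite t0.
have /cvg_ex[r1 c1] : cvgn (fun n => complex.Re (neumann n k)).
  apply: (cvgn_geometric_increments (C := 1) t01) => n.
  by have := le_trans (Re_le_normc _) (incr n); rewrite ReB.
have /cvg_ex[r2 c2] : cvgn (fun n => complex.Im (neumann n k)).
  apply: (cvgn_geometric_increments (C := 1) t01) => n.
  by have := le_trans (Im_le_normc _) (incr n); rewrite ImB.
by exists (Complex r1 r2); split.
Qed.

Lemma neumann_fixpoint : exists y : site -> R[i],
  [/\ l2le y ((1 - t) ^- 2), forall k, y k = b k + a * V y k &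
      forall k, cvgC (fun n => neumann n k) (y k)].
Proof.
have [y yP] := choice neumann_cvg.
exists y; split=> //; first exact: (l2le_cvgC neumann_l2 yP).
move=> k; apply: (cvgC_unique (cvgC_shift (yP k))).
apply: cvgCD; first exact: cvgC_cst.
by apply: cvgCMr; apply: cvgCD; apply: cvgCMr.
Qed.

End fixpoint.

(** Each substitution of the equation into itself multiplies the bound on the squared norm by |a|^2,
    so the norm is zero. *)
Lemma contraction_fixpoint0 (V : (site -> R[i]) -> site -> R[i]) (a : R[i])
    (y : site -> R[i]) :
  (forall x M, l2le x M -> l2le (V x) M) -> normc a < 1 -> l2 y ->
  (forall k, y k = a * V y k) -> forall k, y k = 0.
Proof.
move=> Vcontr a1 [M yM] yE k.
have yn n : l2le y ((normc a ^+ 2) ^+ n * M).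
  elim: n => [|n IHn]; first by rewrite mul1r.
  move=> s us; rewrite (eq_bigr (fun k => normc (a * V y k) ^+ 2)) => [|j _].
    by rewrite exprS -mulrA; exact: (l2le_scale a (Vcontr _ _ IHn)).
  by rewrite {1}yE.
have cv0 : (fun n => (normc a ^+ 2) ^+ n * M) @ \oo --> (0 : R).
  rewrite -[X in _ --> X](mul0r M); apply: cvgMl; apply: cvg_expr.
  by rewrite ger0_norm ?sqr_ge0// exprn_ilt1 ?normc_ge0.
have : normc (y k) ^+ 2 <= 0.
  rewrite -(cvg_lim _ cv0)//; apply: limr_ge; first by apply/cvg_ex; exists 0.
  by apply: nearW => n; exact: l2le_pt (yn n).
move=> y0; have /eqP : normc (y k) ^+ 2 == 0 by rewrite eq_le y0 sqr_ge0.
by move/eqP; rewrite expf_eq0/= => /eqP /Normc.eq0_normc.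
Qed.

End iteration.
(** * The resolvent *)

Section resolvent.
Variable R : realType.
Implicit Types (w : site -> circle R) (phi : R) (z : R[i]) (x y : site -> R[i]).
Local Notation normc := (@Normc.normc R).

Lemma normc_circle (u : circle R) : normc (val u) = 1.
Proof. by apply/eqP; exact: (valP u). Qed.

(** Since U = D S(phi), the inverse first applies the conjugate phases and then S(phi)^-1, which is
    S with both permutations inverted and the angle negated. *)
Definition Uinv w phi x (k : site) : R[i] :=
  rot sigL sigR (- phi) (fun j => conjc (val (w j)) * x j) k.

Lemma l2le_Uop w phi x M : l2le x M -> l2le (Uop w phi x) M.
Proof.
move=> xM.
have := @l2le_rot _ sigL_inv sigR_inv phi x M (can_inj sigL_invK) _ xM.
move=> /(_ _)/(l2le_unimodular (fun k => normc_circle (w k))); apply.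
exists (fun k => sigL (sigR_inv k)) => k /=; last by rewrite sigLK.
by rewrite [in X in sigL X]sigL_sigR_inv sigRK sigL_invK.
Qed.

Lemma l2le_Uinv w phi x M : l2le x M -> l2le (Uinv w phi x) M.
Proof.
move=> xM; apply: l2le_rot; first exact: can_inj sigLK.
  exists (fun k => sigL_inv (sigR k)) => k /=; last by rewrite sigL_invK.
  by rewrite [in X in sigL_inv X]sigL_inv_sigR sigR_invK sigLK.
by apply: l2le_unimodular => // k; rewrite normc_conjc normc_circle.
Qed.

Lemma cos2Dsin2_complex phi :
  (cos phi)%:C%C ^+ 2 + (sin phi)%:C%C ^+ 2 = 1 :> R[i].
Proof. by rewrite -!rmorphXn -rmorphD cos2Dsin2. Qed.

Lemma imaginary_sqr : Complex 0 1 * Complex 0 1 = -1 :> R[i].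
Proof. by apply/eqP; rewrite eq_complex /=; apply/andP; split; apply/eqP; ring. Qed.

Lemma UinvK w phi x k : Uop w phi (Uinv w phi x) k = x k.
Proof.
rewrite /Uop /SL /SR /Uinv /rot cosN sinN rmorphN sigL_invK sigR_invK.
rewrite sigL_sigR_inv.
have ww := mulc_conjc (normc_circle (w k)).
have cs := cos2Dsin2_complex phi; have ii := imaginary_sqr.
set c := (cos phi)%:C%C in cs *; set s := (sin phi)%:C%C in cs *.
set i := Complex 0 1 in ii *; set u := val (w k) in ww *.
set b := conjc (val (w _)) * x (sigR _).
transitivity (u * conjc u * x k * (c ^+ 2 - (i * i) * s ^+ 2)); first by ring.
by rewrite ww ii mulN1r opprK cs mul1r mulr1.
Qed.

Lemma UopK w phi x k : Uinv w phi (Uop w phi x) k = x k.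
Proof.
have ww j := mulc_conjc (normc_circle (w j)).
rewrite /Uinv /rot cosN sinN rmorphN /Uop /SL /SR !sigLK !sigRK sigL_inv_sigR.
have cs := cos2Dsin2_complex phi; have ii := imaginary_sqr.
set c := (cos phi)%:C%C in cs *; set s := (sin phi)%:C%C in cs *.
set i := Complex 0 1 in ii *.
set b := x (sigR_inv _).
have := ww (sigL k); have := ww (sigR k).
set u := val (w (sigR k)); set v := val (w (sigL k)) => uu vv.
transitivity (c * (v * conjc v) * (c * x k + i * s * b)
  - i * s * (u * conjc u) * (c * b + i * s * x k)); first by ring.
rewrite uu vv !mulr1.
transitivity (x k * (c ^+ 2 - (i * i) * s ^+ 2)); first by ring.
by rewrite ii mulN1r opprK cs mulr1.
Qed.

Lemma resolvent_kernel0 w phi z x : normc z != 1 -> l2 x ->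
  (forall k, Uop w phi x k - z * x k = 0) -> forall k, x k = 0.
Proof.
move=> z1 x2 xE; have {}xE k : Uop w phi x k = z * x k.
  by apply/eqP; rewrite -subr_eq0 xE.
have [zlt|zgt|/eqP] := ltgtP (normc z) 1; last by rewrite (negbTE z1).
  apply: (contraction_fixpoint0 (V := Uinv w phi) (a := z)) => // [|k].
    by move=> y M; exact: l2le_Uinv.
  rewrite -{1}(UopK w phi x k) /Uinv /rot !xE; ring.
have z0 : z != 0 by rewrite -normc_eq0 gt_eqF// (lt_trans _ zgt).
apply: (contraction_fixpoint0 (V := Uop w phi) (a := z^-1)) => // [||k].
- by move=> y M; exact: l2le_Uop.
- by rewrite Normc.normcV invf_lt1 // (lt_trans _ zgt).
- by rewrite xE mulKf.
Qed.

(* For |z| > 1 the resolvent equation is y = - e_nu / z + (1 / z) U y, for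
   |z| < 1 it is y = U^-1 e_nu + z U^-1 y. *)
Definition resolvent_seq w phi z (nu : site) : nat -> site -> R[i] :=
  if normc z < 1 then
    neumann sigL sigR (fun k => (cos (- phi))%:C%C * conjc (val (w (sigL k))))
      (fun k => Complex 0 1 * (sin (- phi))%:C%C * conjc (val (w (sigR k))))
      z (Uinv w phi (fun k => (k == nu)%:R))
  else
    neumann sigL_inv sigR_inv (fun k => val (w k) * (cos phi)%:C%C)
      (fun k => val (w k) * (Complex 0 1 * (sin phi)%:C%C))
      z^-1 (fun k => - z^-1 * (k == nu)%:R).

(** A bound on the squared norm of a column; the subtracted term is the contraction factor of the
    Neumann iteration used for this [z]. *)
Definition resolvent_bound z : R :=
  (1 - (if normc z < 1 then normc z else (normc z)^-1)) ^- 2.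

Lemma resolvent_exists w phi z nu : normc z != 1 -> exists y,
  [/\ l2le y (resolvent_bound z),
      forall k, Uop w phi y k - z * y k = (k == nu)%:R &
      forall k, cvgC (fun n => resolvent_seq w phi z nu n k) (y k)].
Proof.
move=> z1; rewrite /resolvent_seq /resolvent_bound; case: ifPn => [zlt|].
  pose A k := (cos (- phi))%:C%C * conjc (val (w (sigL k))).
  pose B k := Complex 0 1 * (sin (- phi))%:C%C * conjc (val (w (sigR k))).
  have VE x k : A k * x (sigL k) + B k * x (sigR k) = Uinv w phi x k.
    by rewrite /A /B /Uinv /rot; ring.
  have [x M xM||y [y2 yE ycvg]] :=
    @neumann_fixpoint R sigL sigR A B _ z (Uinv w phi (fun k => (k == nu)%:R)) zlt.
  - rewrite (_ : (fun k => _) = Uinv w phi x); first exact: l2le_Uinv.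
    by apply/funext => k; exact: VE.
  - by apply: l2le_Uinv; exact: l2le_delta.
  exists y; split=> // k.
  have yE' j : y j = Uinv w phi (fun k => (k == nu)%:R + z * y k) j.
    by rewrite yE VE /Uinv /rot; ring.
  rewrite (_ : Uop w phi y k = (k == nu)%:R + z * y k) ?addrK//.
  by rewrite -(UinvK w phi (fun k => (k == nu)%:R + z * y k)) /Uop /SL /SR -!yE'.
rewrite -leNgt le_eqVlt eq_sym (negbTE z1)/= => zgt.
have z0 : z != 0 by rewrite -normc_eq0 gt_eqF// (lt_trans _ zgt).
have z'1 : normc z^-1 < 1 by rewrite Normc.normcV invf_lt1 // (lt_trans _ zgt).
pose A k := val (w k) * (cos phi)%:C%C.
pose B k := val (w k) * (Complex 0 1 * (sin phi)%:C%C).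
have VE x k : A k * x (sigL_inv k) + B k * x (sigR_inv k) = Uop w phi x k.
  by rewrite /A /B /Uop /SL /SR; ring.
have [x M xM||y [y2 yE ycvg]] :=
  @neumann_fixpoint R sigL_inv sigR_inv A B _ z^-1 (fun k => - z^-1 * (k == nu)%:R) z'1.
- rewrite (_ : (fun k => _) = Uop w phi x); first exact: l2le_Uop.
  by apply/funext => k; exact: VE.
- move=> s us; have := l2le_scale (- z^-1) (@l2le_delta R nu) us.
  move=> /le_trans; apply.
  by rewrite mulr1 normc_opp expr_le1 ?normc_ge0 // ltW.
rewrite Normc.normcV in y2.
exists y; split=> // k.
by rewrite yE VE; field.
Qed.

Lemma resolvent_unique w phi z nu y mu : normc z != 1 -> l2 y ->
  (forall k, Uop w phi y k - z * y k = (k == nu)%:R) ->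
  resolvent_entry w phi z mu nu = y mu.
Proof.
move=> z1 [M yM] yE; rewrite /resolvent_entry; case: xgetP => [c _ [x [[N xN] xE <-]]|].
  suff : x mu + (-1) * y mu = 0 by move/eqP; rewrite mulN1r subr_eq0 => /eqP.
  apply: (@resolvent_kernel0 w phi z (fun k => x k + (-1) * y k)) => // [|k].
    by apply: l2le_l2; apply: l2le_add xN _; exact: l2le_scale yM.
  transitivity ((Uop w phi x k - z * x k) - (Uop w phi y k - z * y k)).
    by rewrite /Uop /SL /SR; ring.
  by rewrite xE yE subrr.
by move=> /(_ (y mu)) /=; case; exists y; split=> //; exists M.
Qed.

Section entries.
Variables (w : site -> circle R) (phi : R) (z : R[i]) (nu : site).
Hypothesis z1 : normc z != 1.
Let G k := resolvent_entry w phi z k nu.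

Lemma resolvent_entryP :
  [/\ l2le G (resolvent_bound z), forall k, Uop w phi G k - z * G k = (k == nu)%:R &
      forall k, cvgC (fun n => resolvent_seq w phi z nu n k) (G k)].
Proof.
have [y [y2 yE ycvg]] := resolvent_exists w phi nu z1.
suff -> : G = y by [].
by apply/funext => k; apply: resolvent_unique => //; exact: l2le_l2 y2.
Qed.

End entries.
End resolvent.
(** * The circle *)

Section circle.
Variable R : realType.
Local Notation normc := (@Normc.normc R).
Local Notation pi := (@pi R).
Implicit Types (t u r : R) (a b : R[i]).

Lemma sin_mean_value u : 0 < u -> exists2 c : R, 0 < c < u & sin u = cos c * u.
Proof.
move=> u0.
have sin_cont : {within `[0, u], continuous (@sin R)}.
  by apply: continuous_subspaceT => x; exact: continuous_sin.
have [c] := MVT u0 (fun x _ => is_derive_sin x) sin_cont.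
by rewrite in_itv/= sin0 !subr0 => cu ->; exists c.
Qed.

Lemma normr_sin_le u : `|sin u| <= `|u|.
Proof.
wlog u0 : u / 0 < u => [hw|].
  have [/hw//|u0|<-] := ltgtP 0 u; last by rewrite sin0.
  by rewrite -(normrN u) -(normrN (sin u)) -sinN hw// oppr_gt0.
by have [c _ ->] := sin_mean_value u0; rewrite normrM ler_piMl ?cos_max.
Qed.

Lemma cos_ge_half u : 0 <= u <= pi / 4 -> 2^-1 <= cos u.
Proof.
move=> /andP[u0 u4]; have p0 := pi_gt0 R.
have cu : 0 <= cos u by apply: cos_ge0_pihalf; apply/andP; split; lra.
have cu2 : 0 <= cos (u *+ 2).
  by apply: cos_ge0_pihalf; rewrite (mulr2n u); apply/andP; split; lra.
by rewrite cos_mulr2n (mulr2n (_ ^+ 2)) in cu2; nra.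
Qed.

(** A crude form of Jordan's inequality: after the double angle formula all angles are at most pi /
    4, where the cosine is at least 1/2. *)
Lemma sin_ge u : 0 <= u <= pi / 2 -> u / 4 <= sin u.
Proof.
move=> /andP[]; rewrite le_eqVlt => /orP[/eqP <- _|u0 u2].
  by rewrite sin0 mul0r.
have v0 : 0 < u / 2 by rewrite divr_gt0.
have [c /andP[c0 cu] su] := sin_mean_value v0.
have -> : sin u = 2 * (cos (u / 2) * (cos c * (u / 2))).
  by rewrite -su mulr_natl -sin_mulr2n (_ : (u / 2) *+ 2 = u)//; lra.
have h1 : 2^-1 <= cos (u / 2) by apply: cos_ge_half; apply/andP; split; lra.
have h2 : 2^-1 <= cos c by apply: cos_ge_half; apply/andP; split; lra.
have : 2^-1 * (2^-1 * (u / 2)) <= cos (u / 2) * (cos c * (u / 2)).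
  by apply: ler_pM => //; [nra|rewrite ler_pM2r].
by lra.
Qed.

Lemma normc_expi2pi t : normc (expi2pi t) = 1.
Proof. by rewrite /expi2pi /= cos2Dsin2 sqrtr1. Qed.

Lemma normc_expi2piB t u :
  normc (expi2pi t - expi2pi u) = 2 * `|sin (pi * (t - u))|.
Proof.
apply/eqP; rewrite -(eqrXn2 (n := 2)) ?normc_ge0 ?mulr_ge0//; apply/eqP.
rewrite sqr_normc exprMn real_normK ?num_real// /expi2pi /=.
have e : cos (2 * pi * (t - u)) = 1 - 2 * sin (pi * (t - u)) ^+ 2.
  rewrite -mulrA mulr_natl cos_mulr2n cos2sin2 -mulr_natl; ring.
rewrite mulrBr cosB in e.
have := cos2Dsin2 (2 * pi * t); have := cos2Dsin2 (2 * pi * u).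
rewrite sqrrB sqrrB; lra.
Qed.

(** A chord is at least as long as the distance of the angles modulo 1: it equals 2 sin(pi x) with x
    at most 1/2, and this is at least pi x / 2, hence at least x. The three cases are the possible
    representatives modulo 1. *)
Lemma near_angle t u r : 0 <= t < 1 -> 0 <= u < 1 ->
  normc (expi2pi t - expi2pi u) < r ->
  [\/ `|t - u| < r, `|t - (u + 1)| < r | `|t - (u - 1)| < r].
Proof.
move=> /andP[t0 t1] /andP[u0 u1].
rewrite normc_expi2piB; set d := t - u => dr.
wlog d0 : t u t0 t1 u0 u1 @d dr / 0 <= d => [hw|].
  have [d0|d0] := leP 0 d; first exact: hw.
  have := hw u t u0 u1 t0 t1; rewrite /= -opprB -/d mulrN sinN !normrN oppr_ge0.
  move=> /(_ dr (ltW d0)).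
  rewrite (_ : u - (t + 1) = - (t - (u - 1))); last by lra.
  rewrite (_ : u - (t - 1) = - (t - (u + 1))); last by lra.
  by rewrite !normrN => -[]; [constructor 1|constructor 3|constructor 2].
have p2 := pi_ge2 R.
have d1 : d < 1 by rewrite /d; lra.
have sge (x : R) : 0 <= x <= 2^-1 -> x <= 2 * `|sin (pi * x)|.
  move=> /andP[x0 x1]; have : pi * x / 4 <= sin (pi * x) by apply: sin_ge; nra.
  by move=> h; have := ler_norm (sin (pi * x)); nra.
have [d2|d2] := leP d 2^-1.
  by constructor 1; rewrite ger0_norm// (le_lt_trans _ dr)// sge// d0.
constructor 2; rewrite (_ : t - (u + 1) = - (1 - d)); last by rewrite /d; lra.
rewrite normrN ger0_norm; last by lra.
apply: le_lt_trans dr; rewrite (le_trans (sge (1 - d) _))//; first by lra.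
rewrite mulrBr mulr1 [pi - _]addrC sinDpi sinN opprK//.
Qed.

Lemma expi2pi_inj t u : 0 <= t < 1 -> 0 <= u < 1 ->
  expi2pi t = expi2pi u -> t = u.
Proof.
move=> t01 u01 e; apply/eqP; rewrite -subr_eq0 -normr_le0; apply/negP => /negP.
rewrite -ltNge => d0; have d1 : `|t - u| < 1 by rewrite ltr_norml; lra.
(* The radius is the distance of [t] and [u] modulo 1, so none of the three strict inequalities can
   hold. *)
have [] := @near_angle t u (Num.min `|t - u| (1 - `|t - u|)) t01 u01.
- rewrite e subrr Normc.normc0 lt_min d0 subr_gt0//.
- by rewrite lt_min ltxx.
- rewrite lt_min => /andP[_]; rewrite ltr_norml; case: (ger0P (t - u)); lra.
- rewrite lt_min => /andP[_]; rewrite ltr_norml; case: (ger0P (t - u)); lra.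
Qed.

Lemma expi2pi_surj a : normc a = 1 -> exists2 t, 0 <= t < 1 & a = expi2pi t.
Proof.
move=> a1; have := sqr_normc a; rewrite a1 expr1n; case: a {a1} => x y /= xy.
have p0 := pi_gt0 R; have pp : 0 < 2 * pi by lra.
have x11 : -1 <= x <= 1 by apply/andP; split; nra.
have ac : cos (acos x) = x by apply: acosK; rewrite in_itv.
have ac0 := acos_ge0 x11; have acpi := acos_lepi x11.
have as_ : sin (acos x) = `|y| by rewrite sin_acos// xy addrC addKr sqrtr_sqr.
have [y0|y0] := leP 0 y.
  exists (acos x / (2 * pi)).
    by rewrite divr_ge0 ?(ltW pp)//= ltr_pdivrMr//; lra.
  by rewrite /expi2pi mulrC divfK ?mulf_neq0 ?gt_eqF// ac as_ ger0_norm.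
have ax0 : 0 < acos x.
  rewrite lt_neqAle ac0 andbT; apply/eqP => e; move: as_; rewrite -e sin0.
  by move/eqP; rewrite eq_sym normr_eq0 lt_eqF.
exists (1 - acos x / (2 * pi)).
  rewrite subr_ge0 ler_pdivrMr// ltrBlDr ltrDl divr_gt0//.
  by rewrite andbT; lra.
rewrite /expi2pi; have -> : 2 * pi * (1 - acos x / (2 * pi)) = - acos x + pi *+ 2.
  rewrite mulrBr mulr1 (mulrC _ (acos x / _)) divfK ?gt_eqF//.
  by rewrite addrC mulr_natl.
by rewrite cosD2pi sinD2pi cosN sinN ac as_ ltr0_norm// opprK.
Qed.

Lemma lebesgue_measure_ball_le (c r : R) : 0 <= r ->
  (lebesgue_measure [set t : R | (`|t - c| < r)%R] <= (2 * r)%:E)%E.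
Proof.
move=> r0; rewrite (_ : [set t | _] = `]c - r, c + r[%classic); last first.
  by apply/seteqP; split => t /=; rewrite in_itv/= ltr_norml; lra.
rewrite lebesgue_measure_itv/= lte_fin; case: ifP => _; last by rewrite lee_fin; lra.
by rewrite -EFinD lee_fin; lra.
Qed.

Lemma measurable_ball_set (c r : R) : measurable [set t : R | (`|t - c| < r)%R].
Proof.
rewrite (_ : [set t | _] = `]c - r, c + r[%classic); first exact: measurable_itv.
by apply/seteqP; split => t /=; rewrite in_itv/= ltr_norml; lra.
Qed.

(** If |b| is the larger coefficient, then a + b e = b (e - rho e_u), where rho = |a / b| and e_u is
    the direction of - a / b. If e is within r of rho e_u, then |rho - 1| < r because e is a unit
    vector, so e is within 2 r of e_u. In the other case, conjugating and multiplying by e exchanges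
    the coefficients and keeps the modulus. *)
Lemma affine_sublevel_cover (a b : R[i]) : exists u : R, forall t r, 0 <= t < 1 ->
  normc (a + b * expi2pi t) < r * Num.max (normc a) (normc b) ->
  [\/ `|t - u| < 2 * r, `|t - (u + 1)| < 2 * r | `|t - (u - 1)| < 2 * r].
Proof.
wlog ab : a b / normc a <= normc b => [hw|].
  have [/hw//|] := boolP (normc a <= normc b); rewrite -ltNge => ba.
  have ba' : normc (conjc b) <= normc (conjc a) by rewrite !normc_conjc; exact: ltW.
  have [u uP] := hw _ _ ba'; exists u => t r t01 h; apply: uP => //.
  have -> : conjc b + conjc a * expi2pi t =
      expi2pi t * conjc (a + b * expi2pi t).
    rewrite rmorphD rmorphM mulrDr mulrCA mulc_conjc ?normc_expi2pi//.
    by rewrite mulr1 addrC mulrC.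
  by rewrite Normc.normcM normc_expi2pi mul1r !normc_conjc maxC.
have [b0|b0] := eqVneq b 0.
  exists 0 => t r _; rewrite b0 in ab *; move: ab; rewrite Normc.normc0 => a0.
  have -> : normc a = 0 by apply/eqP; rewrite eq_le a0 normc_ge0.
  by rewrite maxxx mulr0 ltNge normc_ge0.
have [u u01 abu] : exists2 u, 0 <= u < 1 & - a / b = (normc (a / b))%:C%C * expi2pi u.
  have [->|a0] := eqVneq a 0.
    by exists 0; rewrite ?lexx ?ltr01// oppr0 mul0r Normc.normc0 mul0r.
  have n0 : (normc (a / b))%:C%C != 0.
    rewrite (_ : 0 = 0%:C%C)// (inj_eq (@complexI _)) normc_eq0.
    by rewrite mulf_neq0 ?invr_eq0.
  have [|u u01 uE] := expi2pi_surj (a := - a / b / (normc (a / b))%:C%C).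
    rewrite mulNr mulNr normc_opp Normc.normcM Normc.normcV normc_real.
    by rewrite ger0_norm ?normc_ge0// divff// normc_eq0 mulf_neq0 ?invr_eq0.
  by exists u => //; rewrite -uE [RHS]mulrC divfK.
exists u => t r t01; rewrite (max_idPr ab) => h.
apply: near_angle => //.
have nb0 : 0 < normc b by rewrite lt_neqAle eq_sym normc_eq0 b0 normc_ge0.
set rho := normc (a / b) in abu.
have abE : a + b * expi2pi t = b * (expi2pi t - rho%:C%C * expi2pi u).
  by rewrite -abu; field.
have h1 : normc (expi2pi t - rho%:C%C * expi2pi u) < r.
  by move: h; rewrite abE Normc.normcM mulrC ltr_pM2r.
have h2 : normc (rho%:C%C * expi2pi u - expi2pi u) < r.
  rewrite -{2}(mul1r (expi2pi u)) -mulrBl Normc.normcM normc_expi2pi mulr1.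
  rewrite -(rmorph1 (real_complex R)) -rmorphB normc_real.
  have rho0 : 0 <= rho by exact: normc_ge0.
  apply: le_lt_trans h1.
  have e1 : normc (rho%:C%C * expi2pi u) = rho.
    by rewrite Normc.normcM normc_expi2pi mulr1 normc_real ger0_norm.
  have := normcB_ge (expi2pi t) (rho%:C%C * expi2pi u).
  have := normcB_ge (rho%:C%C * expi2pi u) (expi2pi t).
  rewrite [normc (_ - expi2pi t)]normcB_sym e1 normc_expi2pi => k1 k2.
  by rewrite ler_norml; lra.
have -> : expi2pi t - expi2pi u = (expi2pi t - rho%:C%C * expi2pi u) +
    (rho%:C%C * expi2pi u - expi2pi u) by ring.
by apply: le_lt_trans (normcD_le _ _) _; lra.
Qed.

End circle.
(** * Fractional moments of small quantities *)

Section decoupling.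
Variable R : realType.
Implicit Types (r s : R).

Lemma ler_powRN (x y : R) s : 0 <= s -> 0 < x -> x <= y -> y `^ (- s) <= x `^ (- s).
Proof.
move=> s0 x0 xy; have y0 := lt_le_trans x0 xy.
by rewrite !powRN lef_pV2 ?posrE ?powR_gt0// ge0_ler_powR ?nnegrE ?(ltW x0) ?(ltW y0).
Qed.

Lemma measurable_sublevel d (T : measurableType d) (f : T -> R) (r : R) :
  measurable_fun setT f -> measurable [set x | f x < r].
Proof.
move=> mf; rewrite (_ : [set x | _] = setT `&` f @^-1` `]-oo, r[%classic).
  by apply: mf => //; exact: measurable_itv.
by rewrite setTI; apply/seteqP; split => x /=; rewrite in_itv.
Qed.

(** A discrete layer-cake bound: the dyadic interval that contains [x] contributes a term which
    alone dominates the left-hand side. The lower cut-off on [x] keeps the sum finite. *)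
Lemma powRN_dyadic s r (x : R) n : 0 <= s -> 0 < r -> r * 2^-1 ^+ n <= x ->
  x `^ (- s) <= r `^ (- s) +
    \sum_(k < n) (r * 2^-1 ^+ k.+1) `^ (- s) * \1_[set y | y < r * 2^-1 ^+ k] x.
Proof.
move=> s0 r0; elim: n => [|n IHn].
  by rewrite expr0 mulr1 big_ord0 addr0; exact: ler_powRN.
rewrite big_ord_recr/= => rx; have [xn|xn] := leP (r * 2^-1 ^+ n) x.
  by rewrite (le_trans (IHn xn))// addrA lerDl mulr_ge0 ?powR_ge0.
rewrite [X in _ * X]indicE mem_set//= mulr1 addrA.
rewrite (@le_trans _ _ ((r * 2^-1 ^+ n.+1) `^ (- s)))//.
  by apply: ler_powRN => //; rewrite mulr_gt0 ?exprn_gt0.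
by rewrite lerDr addr_ge0 ?powR_ge0 ?sumr_ge0// => k _; rewrite mulr_ge0 ?powR_ge0.
Qed.

Lemma sum_geometric_le (rho : R) n : 0 <= rho < 1 ->
  \sum_(k < n) rho ^+ k <= (1 - rho)^-1.
Proof.
move=> /andP[rho0 rho1]; have rho' : 0 < 1 - rho by rewrite subr_gt0.
rewrite -[leRHS]mul1r ler_pdivlMr// mulrC -opprB mulNr -subrX1 opprB.
by rewrite gerBl exprn_ge0.
Qed.

Lemma ge0_integral_combination d (T : measurableType d)
    (mu : {measure set T -> \bar R}) (I : Type) (l : seq I) (c : I -> R)
    (f : I -> T -> R) :
  (forall i, measurable_fun setT (f i)) -> (forall i x, 0 <= f i x) ->
  (forall i, 0 <= c i) ->
  (\int[mu]_x (\sum_(i <- l) c i * f i x)%:E =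
   \sum_(i <- l) (c i)%:E * \int[mu]_x (f i x)%:E)%E.
Proof.
move=> mf f0 c0; under eq_integral do rewrite -sumEFin.
rewrite ge0_integral_sum//.
- apply: eq_bigr => i _; under eq_integral do rewrite EFinM.
  rewrite ge0_integralZl ?lee_fin//; first exact/measurable_EFinP.
  by move=> x _; rewrite lee_fin.
- by move=> i; apply/measurable_EFinP; apply: measurable_funM.
- by move=> i x _; rewrite lee_fin mulr_ge0.
Qed.

(* Off the set [q < eps] the weight [q ^ s] is bounded below; on it [d ^ - s] is
   at most [r ^ - s] unless [d < r], where it is dominated by a dyadic sum. Both
   contributions are made smaller than half of the lower bound [2 ^ - s] of the
   left-hand side. *)
Lemma powRN_decoupling s (C : R) : 0 < s < 1 -> 0 < C -> exists2 K : R, 0 < K &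
  forall d (T : measurableType d) (mu : probability T R) (f q : T -> R) (delta : R),
    measurable_fun setT f -> measurable_fun setT q ->
    0 < delta -> (forall x, delta <= f x <= 2) -> (forall x, 0 <= q x) ->
    (forall r, 0 <= r -> (mu [set x | (f x < r)%R] <= (C * r)%:E)%E) ->
    (forall r, 0 <= r -> (mu [set x | (q x < r)%R] <= (C * r)%:E)%E) ->
    (\int[mu]_x (f x `^ (- s))%:E <=
     K%:E * \int[mu]_x (q x `^ s * f x `^ (- s))%:E)%E.
Proof.
move=> /andP[s0 s1] C0; have s0' := ltW s0.
pose h : R := 2^-1; have h0 : 0 < h by rewrite invr_gt0.
(* The ratio of the dyadic series: halving the level multiplies the value by h^-s and the measure
   bound by h. It is below 1 because s < 1. *)
pose rho := h * h `^ (- s).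
have rhoE : rho = h `^ (1 - s).
  rewrite powRD; last by apply/implyP => _; rewrite gt_eqF.
  by rewrite powRr1 ?(ltW h0).
have rho01 : 0 <= rho < 1.
  rewrite rhoE powR_ge0/=.
  have e1 : 1 `^ (1 - s) = 1 :> R by rewrite powR1.
  rewrite -[X in _ < X]e1.
  by rewrite gt0_ltr_powR ?nnegrE ?subr_gt0 ?(ltW h0)// /h; lra.
pose c0 : R := 2 `^ (- s); have c00 : 0 < c0 by rewrite powR_gt0.
pose B := C * h `^ (- s) * (1 - rho)^-1.
have B0 : 0 < B.
  by rewrite !mulr_gt0 ?powR_gt0// invr_gt0 subr_gt0; case/andP: rho01.
(* Chosen so that the whole dyadic series contributes at most [c0 / 4]. *)
pose r := (c0 / (4 * B)) `^ (1 - s)^-1.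
have B4 : 0 < c0 / (4 * B) by apply: divr_gt0 => //; exact: mulr_gt0.
have r0 : 0 < r by exact: powR_gt0.
have rE : r `^ (1 - s) * B = c0 / 4.
  rewrite -powRrM mulVf ?subr_eq0 ?gt_eqF// powRr1; last first.
    exact: ltW.
  by field; rewrite gt_eqF.
(* Chosen so that the term from [q < eps], [r <= f] contributes at most [c0 / 4]. *)
pose eps := c0 / (4 * C * r `^ (- s)).
have eps0 : 0 < eps by rewrite divr_gt0 ?mulr_gt0 ?powR_gt0.
have epsE : r `^ (- s) * (C * eps) = c0 / 4.
  by rewrite /eps; field; rewrite !gt_eqF ?powR_gt0.
exists (2 * eps `^ (- s)); first by rewrite mulr_gt0 ?powR_gt0.
move=> d T mu f q delta mf mq delta0 f2 q0 muf muq.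
have f0 x : 0 < f x by case/andP: (f2 x) => /(lt_le_trans delta0).
(* The number of scales depends on [delta], but the bound on the geometric series does not; hence
   [K] is independent of [delta]. *)
have [n nP] : exists n, r * h ^+ n <= delta.
  exists (Num.Def.archi_bound (r / delta)); rewrite /h exprVn ler_pdivrMr ?exprn_gt0//.
  by rewrite -ler_pdivrMl// mulrC ltW// upper_nthrootP.
(* Index 0 is the weighted integrand, index 1 the event that [q] is small, and the later indices are
   the dyadic levels of [f]. *)
pose c i := match i with 0%N => eps `^ (- s) | 1%N => r `^ (- s)
  | k.+2 => (r * h ^+ k.+1) `^ (- s) end.
pose g i : T -> R := match i with 0%N => fun x => q x `^ s * f x `^ (- s)
  | 1%N => \1_[set x | q x < eps]
  | k.+2 => \1_[set x | f x < r * h ^+ k] end.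
have mfs : measurable_fun setT (fun x => f x `^ (- s)).
  exact: measurableT_comp (measurable_powR _) mf.
have mg i : measurable_fun setT (g i).
  case: i => [|[|i]] /=; last 2 first.
  - by apply: measurable_indic; exact: measurable_sublevel.
  - by apply: measurable_indic; exact: measurable_sublevel.
  by apply: measurable_funM => //; exact: measurableT_comp (measurable_powR _) mq.
have g0 i x : 0 <= g i x.
  by case: i => [|[|i]] /=; rewrite ?mulr_ge0 ?powR_ge0// indicE.
have cp i : 0 <= c i by case: i => [|[|i]] /=; rewrite powR_ge0.
have fg x : f x `^ (- s) <= \sum_(i < n.+2) c i * g i x.
  rewrite !big_ord_recl/=; have [qx|qx] := ltP (q x) eps.
    rewrite [X in _ + (_ * X + _)]indicE mem_set//= mulr1.
    rewrite (le_trans (@powRN_dyadic s r (f x) n s0' r0 _))//.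
      by case/andP: (f2 x) => h1 _; exact: le_trans h1.
    by rewrite lerDr !mulr_ge0 ?powR_ge0.
  rewrite mulrA (@le_trans _ _ (eps `^ (- s) * q x `^ s * f x `^ (- s)))//.
    rewrite ler_peMl ?powR_ge0// powRN mulrC ler_pdivlMr ?powR_gt0// mul1r.
    by rewrite ge0_ler_powR ?nnegrE// ltW.
  rewrite lerDl addr_ge0 ?mulr_ge0 ?powR_ge0 ?indicE// sumr_ge0// => k _.
  exact: mulr_ge0 (cp k.+2) (g0 k.+2 x).
have int_fg : (\int[mu]_x (f x `^ (- s))%:E <=
    \sum_(i < n.+2) (c i)%:E * \int[mu]_x (g i x)%:E)%E.
  rewrite -(@ge0_integral_combination _ _ mu _ _ (fun i : 'I_n.+2 => c i))//.
  apply: ge0_le_integral => //.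
  - by move=> x _; rewrite lee_fin powR_ge0.
  - exact/measurable_EFinP.
  - apply/measurable_EFinP; apply: measurable_sum => i.
    exact: measurable_funM.
  - by move=> x _; rewrite lee_fin fg.
have int_g1 : ((c 1%N)%:E * \int[mu]_x (g 1%N x)%:E <= (c0 / 4)%:E)%E.
  rewrite /= integral_indic ?setIT//; last exact: measurable_sublevel.
  by rewrite -epsE EFinM lee_wpmul2l ?lee_fin ?powR_ge0// muq// ltW.
have int_gk : (\sum_(k < n) (c k.+2)%:E * \int[mu]_x (g k.+2 x)%:E <= (c0 / 4)%:E)%E.
  have -> : c0 / 4 = r `^ (1 - s) * B by [].
  apply: (@le_trans _ _ (\sum_(k < n) (r `^ (1 - s) * C * h `^ (- s) * rho ^+ k)%:E)%E).
    apply: lee_sum => k _; rewrite /= integral_indic ?setIT//; last first.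
      exact: measurable_sublevel.
    apply: (@le_trans _ _ (((r * h ^+ k.+1) `^ (- s))%:E * (C * (r * h ^+ k))%:E)%E).
      by rewrite lee_wpmul2l ?lee_fin ?powR_ge0// muf// mulr_ge0 ?exprn_ge0// ltW.
    rewrite -EFinM lee_fin powRM ?exprn_ge0// ?(ltW h0) ?(ltW r0)//.
    have -> : (h ^+ k.+1) `^ (- s) = h `^ (- s) * (h `^ (- s)) ^+ k.
      rewrite -exprS -!powR_mulrn ?powR_ge0 ?(ltW h0)//.
      by rewrite -!powRrM mulrC.
    have -> : r `^ (1 - s) = r * r `^ (- s).
      rewrite powRD ?powRr1 ?(ltW r0)//.
      by apply/implyP => _; rewrite gt_eqF.
    by rewrite /rho exprMn le_eqVlt; apply/orP; left; apply/eqP; ring.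
  rewrite sumEFin lee_fin -mulr_sumr /B !mulrA ler_wpM2l//.
    by rewrite !mulr_ge0 ?powR_ge0// ltW.
  exact: sum_geometric_le.
have c0_le : (c0%:E <= \int[mu]_x (f x `^ (- s))%:E)%E.
  rewrite -[c0%:E]mule1 -(probability_setT mu) -integral_cst//.
  apply: ge0_le_integral => //.
  - by move=> x _; rewrite lee_fin ltW.
  - exact/measurable_EFinP.
  - move=> x _; rewrite lee_fin /c0 ler_powRN//.
    by case/andP: (f2 x).
(* Finiteness of the left-hand integral is what permits absorbing the error [c0 / 2], at most half
   of that integral, into it. *)
have le_delta : (\int[mu]_x (f x `^ (- s))%:E <= (delta `^ (- s))%:E)%E.
  rewrite -[leRHS]mule1 -(probability_setT mu) -integral_cst//.
  apply: ge0_le_integral => //.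
  - by move=> x _; rewrite lee_fin powR_ge0.
  - exact/measurable_EFinP.
  - move=> x _; rewrite lee_fin ler_powRN//.
    by case/andP: (f2 x).
have J0 : (0 <= \int[mu]_x (q x `^ s * f x `^ (- s))%:E)%E.
  by apply: integral_ge0 => x _; rewrite lee_fin mulr_ge0 ?powR_ge0.
move: int_fg; rewrite !big_ord_recl /= => int_fg.
have {int_fg int_g1 int_gk} := le_trans int_fg (leeD2l _ (leeD int_g1 int_gk)).
move: c0_le le_delta J0.
set I := (\int[mu]_x (f x `^ (- s))%:E)%E.
case: I => [i||]//.
case: (\int[mu]_x _)%E => [j||]//; last first.
  move=> _ _ _ _; rewrite gt0_muley ?leey// lte_fin.
  by apply: mulr_gt0 => //; exact: powR_gt0.
rewrite -!EFinM -!EFinD !lee_fin; lra.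
Qed.

End decoupling.
(** * Resampling one phase *)

Section complex_measurability.
Context d (T : measurableType d) (R : realType).
Implicit Types f g : T -> R[i].

Definition cmeasurable f : Prop :=
  measurable_fun setT (fun x => complex.Re (f x)) /\
  measurable_fun setT (fun x => complex.Im (f x)).

Lemma cmeasurable_cst (a : R[i]) : cmeasurable (fun=> a).
Proof. by split; exact: measurable_cst. Qed.

Lemma cmeasurableD f g :
  cmeasurable f -> cmeasurable g -> cmeasurable (fun x => f x + g x).
Proof.
move=> [f1 f2] [g1 g2]; split.
  rewrite (_ : (fun x => _) = fun x => complex.Re (f x) + complex.Re (g x)).
    exact: measurable_funD.
  by apply/funext => x; case: (f x) (g x) => [? ?] [].
rewrite (_ : (fun x => _) = fun x => complex.Im (f x) + complex.Im (g x)).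
  exact: measurable_funD.
by apply/funext => x; case: (f x) (g x) => [? ?] [].
Qed.

Lemma cmeasurableM f g :
  cmeasurable f -> cmeasurable g -> cmeasurable (fun x => f x * g x).
Proof.
move=> [f1 f2] [g1 g2]; split.
  rewrite (_ : (fun x => _) = fun x => complex.Re (f x) * complex.Re (g x) -
    complex.Im (f x) * complex.Im (g x)).
    by apply: measurable_funB; exact: measurable_funM.
  by apply/funext => x; case: (f x) (g x) => [? ?] [].
rewrite (_ : (fun x => _) = fun x => complex.Re (f x) * complex.Im (g x) +
    complex.Im (f x) * complex.Re (g x)).
  by apply: measurable_funD; exact: measurable_funM.
by apply/funext => x; case: (f x) (g x) => [? ?] [].
Qed.

Lemma cmeasurableN f : cmeasurable f -> cmeasurable (fun x => - f x).
Proof.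
move=> mf; rewrite (_ : (fun x => - f x) = fun x => (-1) * f x).
  by apply: cmeasurableM => //; exact: cmeasurable_cst.
by apply/funext => x; rewrite mulN1r.
Qed.

Lemma cmeasurable_conjc f : cmeasurable f -> cmeasurable (fun x => conjc (f x)).
Proof.
move=> [f1 f2]; split.
  rewrite (_ : (fun x => _) = fun x => complex.Re (f x))//.
  by apply/funext => x; case: (f x).
rewrite (_ : (fun x => _) = fun x => - complex.Im (f x)).
  exact: measurable_funN.
by apply/funext => x; case: (f x).
Qed.

Lemma cmeasurable_cvgC (h : nat -> T -> R[i]) f :
  (forall n, cmeasurable (h n)) -> (forall x, cvgC (fun n => h n x) (f x)) ->
  cmeasurable f.
Proof.
move=> mh hf; split.
  apply: (measurable_fun_cvg (h := fun n x => complex.Re (h n x))).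
    by move=> n; case: (mh n).
  by move=> x _; case: (hf x).
apply: (measurable_fun_cvg (h := fun n x => complex.Im (h n x))).
  by move=> n; case: (mh n).
by move=> x _; case: (hf x).
Qed.

Lemma measurable_normc f : cmeasurable f ->
  measurable_fun setT (fun x => Normc.normc (f x)).
Proof.
move=> [f1 f2].
rewrite (_ : (fun x => _) =
    fun x => (complex.Re (f x) ^+ 2 + complex.Im (f x) ^+ 2) `^ 2^-1).
  apply: measurableT_comp (measurable_powR _) _.
  by apply: measurable_funD; exact: measurable_funX.
by apply/funext => x; rewrite powR12_sqrt ?addr_ge0 ?sqr_ge0//; case: (f x).
Qed.

End complex_measurability.

(** * The uniform phase on the circle *)

Section uniform.
Variable R : realType.

Definition unif01 : set (measurableTypeR R) -> \bar R :=
  mrestr (@lebesgue_measure R)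
    (measurable_itv (Interval (BLeft (0 : R)) (BLeft 1))).

HB.instance Definition _ := Measure.on unif01.

Lemma unif01_setT : unif01 setT = 1%E.
Proof.
by rewrite /unif01 /mrestr setTI lebesgue_measure_itv/= lte_fin ltr01 sube0.
Qed.

HB.instance Definition _ := Measure_isProbability.Build _ _ _ unif01 unif01_setT.

(* The value 0 off [0, 1), a null set for [unif01], keeps [cut01] in the domain
   where [expi2pi] is injective. *)
Definition cut01 (t : R) : R := \1_`[0%R, 1%R[ t * t.

Lemma cut01_in (t : R) : 0 <= cut01 t < 1.
Proof.
rewrite /cut01 indicE; case: (boolP (t \in _)); rewrite ?mul0r ?lexx ?ltr01//.
by rewrite inE/= in_itv/= mul1r.
Qed.

Lemma cut01_id (t : R) : 0 <= t < 1 -> cut01 t = t.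
Proof. by move=> t01; rewrite /cut01 indicE mem_set ?mul1r//= in_itv. Qed.

Lemma measurable_cut01 : measurable_fun setT cut01.
Proof. by apply: measurable_funM => //; exact: measurable_indic. Qed.

Definition circ (t : R) : circle R :=
  exist _ (expi2pi (cut01 t)) (introT eqP (normc_expi2pi (cut01 t))).

Lemma cmeasurable_circ : cmeasurable (fun t => val (circ t)).
Proof.
have m2 : measurable_fun setT (fun t => 2 * pi * cut01 t).
  by apply: measurable_funM => //; exact: measurable_cut01.
split => /=.
  apply: (measurableT_comp (f := @cos R)) m2.
  by apply: continuous_measurable_fun; exact: continuous_cos.
apply: (measurableT_comp (f := @sin R)) m2.
by apply: continuous_measurable_fun; exact: continuous_sin.
Qed.

Lemma circle_set_circ (B : set R) (t : R) : circle_set B (circ t) <-> B (cut01 t).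
Proof.
split=> [[u /= [Bu]]|Bt]; last first.
  by exists (cut01 t) => //; split=> //=; rewrite in_itv/=; exact: cut01_in.
by rewrite in_itv/= => u01 e; rewrite (expi2pi_inj (cut01_in t) u01 e).
Qed.

Lemma circle_set_expi2pi (B : set R) (u : circle R) (t : R) : 0 <= t < 1 ->
  val u = expi2pi t -> circle_set B u <-> B t.
Proof.
move=> t01 ut; split=> [[v /= [Bv]]|Bt].
  by rewrite in_itv/= ut => v01 e; rewrite (expi2pi_inj t01 v01 e).
by exists t => //; split=> //=; rewrite in_itv.
Qed.

(** Three intervals of radius [2 * r] have total length [12 * r]. Measuring smallness relative to
    the larger coefficient makes the constant the same for all [a] and [b]. *)
Lemma unif01_affine_sublevel (a b : R[i]) (r : R) : 0 <= r ->
  (unif01 [set t | (Normc.normc (a + b * val (circ t)) <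
     r * Num.max (Normc.normc a) (Normc.normc b))%R] <= (12 * r)%:E)%E.
Proof.
move=> r0; have [u uP] := affine_sublevel_cover a b.
have r20 : 0 <= 2 * r by rewrite mulr_ge0.
pose S c := [set t : R | (`|t - c| < 2 * r)%R].
have mS c : measurable (S c) by exact: measurable_ball_set.
rewrite /unif01 /mrestr.
apply: (@le_trans _ _ (lebesgue_measure (S u `|` S (u + 1) `|` S (u - 1)))).
  apply: le_measure; rewrite ?inE//.
  - apply: measurableI; last exact: measurable_itv.
    apply: measurable_sublevel; apply: measurable_normc.
    apply: cmeasurableD; first exact: cmeasurable_cst.
    by apply: cmeasurableM; [exact: cmeasurable_cst|exact: cmeasurable_circ].
  - apply: measurableU; last exact: mS.
    by apply: measurableU; exact: mS.
  - move=> t [/= ht]; rewrite in_itv/= => t01; rewrite cut01_id// in ht.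
    by have [] := uP t r t01 ht; [left; left|left; right|right].
apply: (@le_trans _ _ (lebesgue_measure (S u `|` S (u + 1)%R) +
  lebesgue_measure (S (u - 1)%R))%E).
  by apply: measureU2; [apply: measurableU|]; exact: mS.
rewrite (_ : 12 * r = 2 * (2 * r) + 2 * (2 * r) + 2 * (2 * r)); last by ring.
rewrite 2!EFinD leeD ?lebesgue_measure_ball_le//.
apply: (@le_trans _ _ (lebesgue_measure (S u) +
  lebesgue_measure (S (u + 1)%R))%E).
  by apply: measureU2; exact: mS.
by rewrite leeD ?lebesgue_measure_ball_le.
Qed.

End uniform.

(** * Invariance of the product measure under resampling *)

Section resampling.
Variable R : realType.
Local Notation normc := (@Normc.normc R).

Definition resample (k : site) (wt : Omega R * measurableTypeR R) : Omega R :=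
  fun j => if j == k then circ wt.2 else wt.1 j.

Definition cyl (s : seq site) (B : site -> set R) : set (Omega R) :=
  [set w | forall k, k \in s -> circle_set (B k) (w k)].

Lemma measurable_cyl1 (k : site) (B : set R) : measurable B ->
  measurable ([set w | circle_set B (w k)] : set (Omega R)).
Proof. by move=> mB; apply: sub_sigma_algebra; exists k, B. Qed.

Lemma cyl_cons k s B : cyl (k :: s) B = [set w | circle_set (B k) (w k)] `&` cyl s B.
Proof.
apply/seteqP; split => [w wB|w [/= wk ws] j].
  by split => [|j js]; apply: wB; rewrite inE ?eqxx// js orbT.
by rewrite inE => /orP[/eqP ->|/ws].
Qed.

Lemma measurable_cyl s B : (forall k, measurable (B k)) -> measurable (cyl s B).
Proof.
move=> mB; elim: s => [|k s IHs].
  by rewrite (_ : cyl _ _ = setT)//; apply/seteqP; split.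
by rewrite cyl_cons; apply: measurableI => //; exact: measurable_cyl1.
Qed.

(** The generators are parametrized by sets of angles, so a preimage is brought to that form by
    pulling back through [expi2pi]. *)
Lemma cmeasurable_coord (k : site) : cmeasurable (fun w : Omega R => val (w k)).
Proof.
have m2 : measurable_fun setT (fun t : R => 2 * pi * t) by exact: measurable_funM.
have key (f : R[i] -> R) : measurable_fun setT (fun t => f (expi2pi t)) ->
    measurable_fun setT (fun w : Omega R => f (val (w k))).
  move=> mf _ Y mY; rewrite setTI.
  have mfY := mf measurableT Y mY; rewrite setTI in mfY.
  rewrite (_ : _ @^-1` _ = [set w | circle_set ((fun t => f (expi2pi t)) @^-1` Y) (w k)]).
    exact: measurable_cyl1.
  apply/seteqP; split => w /=; have [t t01 wt] := expi2pi_surj (normc_circle (w k)).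
    by move=> wY; apply/(circle_set_expi2pi _ t01 wt); rewrite /= -wt.
  by move=> /(circle_set_expi2pi _ t01 wt) /=; rewrite -wt.
split; apply: (key); rewrite /expi2pi /=.
  apply: (measurableT_comp (f := @cos R)) m2.
  by apply: continuous_measurable_fun; exact: continuous_cos.
apply: (measurableT_comp (f := @sin R)) m2.
by apply: continuous_measurable_fun; exact: continuous_sin.
Qed.

Lemma measurable_circ_preimage (B : set R) : measurable B ->
  measurable [set t : R | circle_set B (circ t)].
Proof.
move=> mB; rewrite (_ : [set t | _] = setT `&` @cut01 R @^-1` B).
  exact: measurable_cut01.
by rewrite setTI; apply/seteqP; split => t /circle_set_circ.
Qed.

Lemma unif01_circ (B : set R) : measurable B ->
  unif01 [set t : R | circle_set B (circ t)] = lebesgue_measure (B `&` `[0%R, 1%R[).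
Proof.
move=> mB; rewrite /unif01 /mrestr; congr (lebesgue_measure _).
apply/seteqP; split => t [/= tB]; rewrite in_itv/= => t01; split; rewrite /= ?in_itv//.
  by move/circle_set_circ : tB; rewrite cut01_id.
by apply/circle_set_circ; rewrite cut01_id.
Qed.

Lemma measurable_resample (k : site) : measurable_fun setT (resample k).
Proof.
apply: (@measurability _ _ _ (Omega R) setT (resample k) (@cyl_gen R)) => //.
move=> _ [_ [j [B [mB ->]]] <-]; rewrite setTI.
have [->|jk] := eqVneq j k.
  rewrite (_ : _ @^-1` _ = setT `*` [set t | circle_set B (circ t)]).
    by apply: measurableX => //; exact: measurable_circ_preimage.
  by apply/seteqP; split => -[w t] /=; rewrite /resample eqxx//= => -[].
rewrite (_ : _ @^-1` _ = [set w : Omega R | circle_set B (w j)] `*` setT).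
  by apply: measurableX => //; exact: measurable_cyl1.
by apply/seteqP; split => -[w t] /=; rewrite /resample (negbTE jk)//= => -[].
Qed.

Variable P : probability (Omega R) R.
Hypothesis hP : is_product_uniform P.

Lemma cyl_measure s B : uniq s -> (forall k, measurable (B k)) ->
  P (cyl s B) = (\prod_(k <- s) lebesgue_measure (B k `&` `[0%R, 1%R[))%E.
Proof. exact: hP. Qed.

(** The preimage of a cylinder is a rectangle: the condition at [k], if there is one, moves to the
    fresh phase, and its factor in the product is supplied by [unif01]. *)
Lemma resample_cyl k s B : uniq s -> (forall k, measurable (B k)) ->
  (P \x @unif01 R)%E (resample k @^-1` cyl s B) = P (cyl s B).
Proof.
move=> us mB.
pose T := if k \in s then [set t : R | circle_set (B k) (circ t)] else setT.
have mT : measurable T.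
  by rewrite /T; case: ifP => _ //; exact: measurable_circ_preimage.
rewrite (_ : _ @^-1` _ = cyl (rem k s) B `*` T); last first.
  apply/seteqP; split => -[w t] /=; rewrite /cyl /resample /=.
    move=> wB; split=> [j|]; first rewrite mem_rem_uniq// inE => /andP[jk js].
      by have := wB j js; rewrite (negbTE jk).
    by rewrite /T; case: ifP => //= ks; have := wB k ks; rewrite eqxx.
  rewrite /T => -[ws wt] j js; case: eqVneq => [jk|jk].
    by move: wt; rewrite -jk js.
  by apply: ws; rewrite mem_rem_uniq// inE/= jk.
rewrite product_measure1E//; last exact: measurable_cyl.
transitivity (P (cyl (rem k s) B) * unif01 T)%E; first by [].
rewrite (cyl_measure us mB) (cyl_measure (rem_uniq k us) mB) /T.
case: ifPn => ks.
  by rewrite (perm_big _ (perm_to_rem ks)) big_cons/= -(unif01_circ (mB k)) muleC.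
by rewrite rem_id// -[RHS]mule1 -(@unif01_setT R).
Qed.

Definition resample_law (k : site) : {measure set (Omega R) -> \bar R} :=
  measure_function_pushforward__canonical__measure_function_Measure
    (P \x @unif01 R)%E (measurable_resample k).

(** Uniqueness of finite measures on a generating pi-system. Cylinders over finite lists are used
    because single-site generators are not stable under intersection. *)
Lemma resample_lawE k (A : set (Omega R)) : measurable A ->
  P A = resample_law k A.
Proof.
pose G := [set A : set (Omega R) | exists s B,
  [/\ uniq s, forall j, measurable (B j) & A = cyl s B]].
apply: (measure_unique G (fun=> setT)).
- apply/seteqP; split.
    apply: smallest_sub; first exact: smallest_sigma_algebra.
    move=> _ [j [B [mB ->]]]; apply: sub_sigma_algebra.
    exists [:: j], (fun=> B); split=> //.
    apply/seteqP; split => w /=; first by move=> wB i; rewrite inE => /eqP ->.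
    by move=> /(_ j); apply; rewrite inE.
  apply: smallest_sub; first exact: sigma_algebra_measurable.
  by move=> _ [s [B [_ mB ->]]]; exact: measurable_cyl.
- move=> _ _ [s [B [us mB ->]]] [s' [B' [us' mB' ->]]].
  (* A site missing from one of the two lists carries no condition from it, hence the default
     [setT]. *)
  pose B'' j := (if j \in s then B j else setT) `&` (if j \in s' then B' j else setT).
  exists (undup (s ++ s')), B''; split; first exact: undup_uniq.
    by move=> j; apply: measurableI; case: ifP.
  have cI (X Y : set R) (u : circle R) :
      circle_set (X `&` Y) u <-> circle_set X u /\ circle_set Y u.
    have [t t01 ut] := expi2pi_surj (normc_circle u).
    split=> [/(circle_set_expi2pi _ t01 ut) [Xt Yt]|].
      by split; apply/(circle_set_expi2pi _ t01 ut).
    by move=> [] /(circle_set_expi2pi _ t01 ut) Xt /(circle_set_expi2pi _ t01 ut) Yt;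
      apply/(circle_set_expi2pi _ t01 ut).
  have cT (u : circle R) : circle_set setT u.
    have [t t01 ut] := expi2pi_surj (normc_circle u).
    exact/(circle_set_expi2pi _ t01 ut).
  apply/seteqP; split => w.
    move=> [ws ws'] j _; apply/cI; split; case: ifP => // js.
      exact: ws.
    exact: ws'.
  move=> ws; split => j js.
    by have [] := (cI _ _ _).1 (ws j _); rewrite ?js// mem_undup mem_cat js.
  by have [] := (cI _ _ _).1 (ws j _); rewrite ?js// mem_undup mem_cat js orbT.
- by move=> _; exists [::], (fun=> setT); split=> //; apply/seteqP; split.
- by apply/seteqP; split => // w _; exists 0%N.
- by move=> _ [s [B [us mB ->]]]; apply/esym; exact: resample_cyl.
- move=> _; suff : (P setT < +oo)%E by [].
  by rewrite probability_setT ltry.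
Qed.

Lemma integral_resample (k : site) (f : Omega R -> \bar R) :
  measurable_fun setT f -> (forall w, (0 <= f w)%E) ->
  (\int[P]_w f w = \int[P]_w \int[@unif01 R]_t f (resample k (w, t)))%E.
Proof.
move=> mf f0; have mk := measurable_resample k.
rewrite (eq_measure_integral (resample_law k)); last first.
  by move=> A mA _; exact: resample_lawE.
rewrite (ge0_integral_pushforward mk)//= preimage_setT.
by rewrite fubini_tonelli1//; exact: measurableT_comp.
Qed.

End resampling.
(** * One step of the recursion *)

Section moments.
Variable R : realType.
Implicit Types (phi : R) (z : R[i]).
Local Notation normc := (@Normc.normc R).

Lemma cmeasurable_neumann d (T : measurableType d) p q (A B b : T -> site -> R[i])
    (a : R[i]) n k :
  (forall k, cmeasurable (A^~ k)) -> (forall k, cmeasurable (B^~ k)) ->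
  (forall k, cmeasurable (b^~ k)) ->
  cmeasurable (fun x => neumann p q (A x) (B x) a (b x) n k).
Proof.
move=> mA mB mb; elim: n k => [|n IHn] k /=; first exact: cmeasurable_cst.
apply: cmeasurableD => //; apply: cmeasurableM; first exact: cmeasurable_cst.
by apply: cmeasurableD; apply: cmeasurableM.
Qed.

(** The entry is defined by choice, which says nothing about measurability; but it is the limit of
    Neumann iterates, each a polynomial in finitely many phases or their conjugates. *)
Lemma cmeasurable_resolvent phi z mu nu : normc z != 1 ->
  cmeasurable (fun w : Omega R => resolvent_entry w phi z mu nu).
Proof.
move=> z1; apply: (cmeasurable_cvgC
  (h := fun n (w : Omega R) => resolvent_seq w phi z nu n mu)).
  have mw (k : site) := @cmeasurable_coord R k.
  have mw' (k : site) := cmeasurable_conjc (mw k).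
  move=> n; rewrite /resolvent_seq; case: (normc z < 1); apply: cmeasurable_neumann => k.
  - by apply: cmeasurableM => //; exact: cmeasurable_cst.
  - by apply: cmeasurableM => //; exact: cmeasurable_cst.
  - by apply: cmeasurableD; (apply: cmeasurableM; first exact: cmeasurable_cst);
      apply: cmeasurableM => //; exact: cmeasurable_cst.
  - by apply: cmeasurableM => //; exact: cmeasurable_cst.
  - by apply: cmeasurableM => //; exact: cmeasurable_cst.
  - exact: cmeasurable_cst.
by move=> w; have [_ _] := resolvent_entryP w phi nu z1; apply.
Qed.

Definition update (w : site -> circle R) (k : site) (u : circle R) : site -> circle R :=
  fun j => if j == k then u else w j.

(* With u and v the columns of the resolvent at [nu] and [mu] for a reference
   phase, the new column is proportional to D u + c v, where D is affine in the
   phase; by the equation at [mu], the value there of D u + c v has modulus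
   independent of the phase. *)
Lemma resolvent_rank_one (w : site -> circle R) phi z mu nu : normc z != 1 ->
  exists a b gamma, forall u : circle R,
    normc (resolvent_entry (update w mu u) phi z mu nu) * normc (a + b * val u) = gamma
    /\ 0 < normc (a + b * val u).
Proof.
move=> z1; pose w1 := update w mu (exist _ 1 (one_in_circle R)).
pose v j := resolvent_entry w1 phi z j mu.
have [v2 vE _] := resolvent_entryP w1 phi mu z1.
(* This is the value at [mu] of (U - z) v when the phase there is [u]; away from [mu] that vector
   vanishes. *)
pose D (u : circle R) := - (z * v mu) + (1 + z * v mu) * val u.
have main (n : site) (u : circle R) :
    D u * resolvent_entry (update w mu u) phi z mu n =
    if n == mu then v mu else val u * resolvent_entry w1 phi z mu n.
  set al := val u.
  have [x2 xE _] := resolvent_entryP w1 phi n z1.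
  have [y2 yE _] := resolvent_entryP (update w mu u) phi n z1.
  set x := (fun k => resolvent_entry w1 phi z k n) in x2 xE.
  set y := (fun k => resolvent_entry (update w mu u) phi z k n) in y2 yE.
  (* Changing the phase perturbs (U - z) x only at [mu]; this multiple of [v] corrects it, so that U
     - z maps [D u * x + c * v] to [D u] times the basis vector at [n]. *)
  pose c := - ((al - 1) * ((mu == n)%:R + z * x mu)).
  have ker : forall k, D u * x k + c * v k + (- D u) * y k = 0.
    apply: (@resolvent_kernel0 _ (update w mu u) phi z) => // [|k].
      apply: l2le_l2; apply: l2le_add (l2le_scale (- D u) y2).
      by apply: l2le_add; apply: l2le_scale; [exact: x2|exact: v2].
    have yk := yE k; have xk := xE k; have vk := vE k.
    transitivity (D u * (Uop (update w mu u) phi x k - z * x k)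
       + c * (Uop (update w mu u) phi v k - z * v k)
       - D u * (Uop (update w mu u) phi y k - z * y k)).
      by rewrite /Uop /SL /SR; ring.
    rewrite yk; have [kmu|kmu] := eqVneq k mu; last first.
      have Uw f : Uop (update w mu u) phi f k = Uop w1 phi f k.
        by rewrite /Uop /w1 /update (negbTE kmu).
      by rewrite !Uw xk vk (negbTE kmu) mulr0n; ring.
    have Uw f : Uop (update w mu u) phi f mu = al * Uop w1 phi f mu.
      by rewrite /Uop /w1 /update eqxx /= mul1r.
    rewrite kmu in xk vk *; rewrite eqxx mulr1n in vk.
    have {}xk : Uop w1 phi x mu = (mu == n)%:R + z * x mu by rewrite -xk subrK.
    have {}vk : Uop w1 phi v mu = 1 + z * v mu by rewrite -[1]vk subrK.
    by rewrite !Uw xk vk /c /D -/al; ring.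
  have /eqP := ker mu; rewrite addr_eq0 -mulNr opprK => /eqP; rewrite /y => <-.
  rewrite /c /D -/al; case: (eqVneq n mu) => [nmu|nmu].
    by rewrite /x nmu -/(v mu) mulr1n; ring.
  by rewrite /x mulr0n; ring.
(* If [D u] vanished, [main] at [n = mu] would give [v mu = 0], and then [D u] would be the
   unimodular number [val u]. *)
have D0 u : D u != 0.
  apply/eqP => Du; have := main mu u; rewrite Du mul0r eqxx => v0.
  move: Du; rewrite /D -v0 mulr0 oppr0 addr0 add0r mul1r => u0.
  by have := normc_circle u; rewrite u0 Normc.normc0 => /eqP; rewrite eq_sym oner_eq0.
exists (- (z * v mu)), (1 + z * v mu),
  (normc (if nu == mu then v mu else resolvent_entry w1 phi z mu nu)) => u.
rewrite -/(D u); split; last by rewrite lt_neqAle eq_sym normc_eq0 D0 normc_ge0.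
rewrite mulrC -Normc.normcM main; case: ifP => // _.
by rewrite Normc.normcM normc_circle mul1r.
Qed.

(** The determinant of the 4x4 block of cos phi D S_L - z on the cycle through [mu]. *)
Definition plaquette_det (w : site -> circle R) phi z (mu : site) : R[i] :=
  z ^+ 4 - (cos phi)%:C%C ^+ 4 * val (w mu) * val (w (sigL_inv mu)) *
    val (w (sigL_inv (sigL_inv mu))) * val (w (sigL_inv (sigL_inv (sigL_inv mu)))).

(** Its fourth power is the larger of the moduli of the two coefficients of [plaquette_det] as an
    affine function of the phase at [mu]. *)
Definition scale phi z : R := Num.max (normc z) `|cos phi|.

Lemma plaquette_det_update w phi z mu : exists b : R[i],
  normc b = `|cos phi| ^+ 4 /\
  forall u, plaquette_det (update w mu u) phi z mu = z ^+ 4 + b * val u.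
Proof.
have [n1 n2 n3] := sigL_inv_neq mu.
exists (- ((cos phi)%:C%C ^+ 4 * val (w (sigL_inv mu)) *
  val (w (sigL_inv (sigL_inv mu))) * val (w (sigL_inv (sigL_inv (sigL_inv mu)))))).
split; first by rewrite normc_opp 3!Normc.normcM normcX normc_real !normc_circle !mulr1.
move=> u; rewrite /plaquette_det /update eqxx (negbTE n1) (negbTE n2) (negbTE n3).
by ring.
Qed.

Definition step (j : nat) (mu : site) : site := sigR_inv (iter j sigL_inv mu).

(* Follow the eigenvalue equation once around the plaquette of [mu]. *)
Lemma plaquette_bound w phi z mu nu : normc z != 1 ->
  normc (plaquette_det w phi z mu) * normc (resolvent_entry w phi z mu nu) <=
  scale phi z ^+ 3 * \sum_(j < 4)
    (`|sin phi| * normc (resolvent_entry w phi z (step j mu) nu) +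
     (iter j sigL_inv mu == nu)%:R).
Proof.
move=> z1; have [_ yE _] := resolvent_entryP w phi nu z1.
pose y k := resolvent_entry w phi z k nu.
have {}yE k : Uop w phi y k - z * y k = (k == nu)%:R := yE k.
pose e k := val (w k) * (Complex 0 1 * (sin phi)%:C%C * y (sigR_inv k)) - (k == nu)%:R.
have yk k : z * y k = val (w k) * (cos phi)%:C%C * y (sigL_inv k) + e k.
  by rewrite /e -yE /Uop /SL /SR; ring.
have en k : normc (e k) <= `|sin phi| * normc (y (sigR_inv k)) + (k == nu)%:R.
  apply: (le_trans (normcD_le _ _)); rewrite normc_opp !Normc.normcM normc_circle.
  rewrite normc_i normc_real !mul1r lerD2l.
  by case: (k == nu); rewrite ?Normc.normc1 ?Normc.normc0.
pose k1 := sigL_inv mu; pose k2 := sigL_inv k1; pose k3 := sigL_inv k2.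
set c := (cos phi)%:C%C in yk.
have y3 := yk k3; rewrite /k3 /k2 /k1 sigL_inv4 -/k1 -/k2 -/k3 in y3.
have key : plaquette_det w phi z mu * y mu = z ^+ 3 * e mu
    + val (w mu) * c * z ^+ 2 * e k1
    + val (w mu) * val (w k1) * c ^+ 2 * z * e k2
    + val (w mu) * val (w k1) * val (w k2) * c ^+ 3 * e k3.
  rewrite /plaquette_det -/k1 -/k2 -/k3 -/c.
  have y0 := yk mu; have y1 := yk k1; have y2 := yk k2.
  rewrite -/k1 in y0; rewrite -/k2 in y1; rewrite -/k3 in y2.
  have z4 : z ^+ 4 * y mu = z ^+ 3 * (z * y mu) by ring.
  rewrite mulrBl z4 y0.
  transitivity (z ^+ 3 * e mu + val (w mu) * c * z ^+ 2 * (z * y k1) -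
    c ^+ 4 * val (w mu) * val (w k1) * val (w k2) * val (w k3) * y mu); first by ring.
  rewrite y1.
  transitivity (z ^+ 3 * e mu + val (w mu) * c * z ^+ 2 * e k1
    + val (w mu) * val (w k1) * c ^+ 2 * z * (z * y k2) -
    c ^+ 4 * val (w mu) * val (w k1) * val (w k2) * val (w k3) * y mu); first by ring.
  rewrite y2.
  transitivity (z ^+ 3 * e mu + val (w mu) * c * z ^+ 2 * e k1
    + val (w mu) * val (w k1) * c ^+ 2 * z * e k2
    + val (w mu) * val (w k1) * val (w k2) * c ^+ 3 * (z * y k3) -
    c ^+ 4 * val (w mu) * val (w k1) * val (w k2) * val (w k3) * y mu); first by ring.
  by rewrite y3; ring.
rewrite -Normc.normcM key.
have t0 : 0 <= scale phi z by rewrite le_max normc_ge0.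
have zt : normc z <= scale phi z by rewrite le_max lexx.
have ct : `|cos phi| <= scale phi z by rewrite le_max lexx orbT.
have zp m : 0 <= normc z ^+ m <= scale phi z ^+ m.
  by rewrite exprn_ge0 ?normc_ge0// lerXn2r ?nnegrE ?normc_ge0.
have cp m : 0 <= `|cos phi| ^+ m <= scale phi z ^+ m.
  by rewrite exprn_ge0//= lerXn2r ?nnegrE.
(* Each coefficient in [key] is, up to phases, a product of three factors z or cos phi: one power of
   [scale] fewer than in the determinant. *)
have mono m n' : (m + n' = 3)%N ->
    `|cos phi| ^+ m * normc z ^+ n' <= scale phi z ^+ 3.
  move=> <-; rewrite exprD; case/andP: (zp n') => z0' zz; case/andP: (cp m) => c0' cc.
  exact: ler_pM.
pose E k := `|sin phi| * normc (y (sigR_inv k)) + (k == nu)%:R.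
have bound k (a : R[i]) : normc a <= scale phi z ^+ 3 ->
    normc (a * e k) <= scale phi z ^+ 3 * E k.
  by move=> ha; rewrite Normc.normcM ler_pM ?normc_ge0// ?en.
rewrite !big_ord_recl big_ord0 addr0 /=.
rewrite -[leRHS]/(scale phi z ^+ 3 * (E mu + (E k1 + (E k2 + E k3)))).
rewrite (mulrDr _ (E mu)) (mulrDr _ (E k1)) (mulrDr _ (E k2)).
have tri (a1 a2 a3 a4 : R[i]) : normc (a1 + a2 + a3 + a4) <=
    normc a1 + normc a2 + normc a3 + normc a4.
  rewrite (le_trans (normcD_le _ _))// lerD2r.
  by rewrite (le_trans (normcD_le _ _))// lerD2r normcD_le.
apply: (le_trans (tri _ _ _ _)); rewrite -!addrA; do 3?[apply: lerD]; apply: bound.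
- by rewrite normcX; case/andP: (zp 3%N).
- rewrite 2!Normc.normcM normcX normc_real normc_circle mul1r.
  by rewrite -[X in X * _]expr1 mono.
- rewrite 3!Normc.normcM normcX normc_real !normc_circle !mul1r.
  by rewrite -[X in _ * X]expr1 mono.
- rewrite 3!Normc.normcM normcX normc_real !normc_circle !mul1r.
  by case/andP: (cp 3%N).
Qed.

End moments.

(** * Decoupling and the recursion for fractional moments *)

Section fractional_moments.
Variable R : realType.
Implicit Types (s phi : R) (z : R[i]).
Local Notation normc := (@Normc.normc R).

(** The fractions x / (x + y) and y / (x + y) lie in [0, 1], so each is at most its own power s;
    they add up to 1. *)
Lemma powRD_le s (x y : R) : 0 < s < 1 -> 0 <= x -> 0 <= y ->
  (x + y) `^ s <= x `^ s + y `^ s.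
Proof.
move=> /andP[s0 s1] x0 y0; have [xy0|xy0] := eqVneq (x + y) 0.
  by rewrite xy0 powR0 ?gt_eqF// addr_ge0 ?powR_ge0.
have xy : 0 < x + y by rewrite lt_neqAle eq_sym xy0 addr_ge0.
have key (u : R) : 0 <= u -> u <= x + y -> u / (x + y) * (x + y) `^ s <= u `^ s.
  move=> u0 uxy; have [->|un0] := eqVneq u 0; first by rewrite !mul0r powR_ge0.
  have uP : 0 < u by rewrite lt_neqAle eq_sym un0.
  have v0 : 0 < u / (x + y) by rewrite divr_gt0.
  rewrite -[in leRHS](divfK xy0 u) powRM ?(ltW v0) ?(ltW xy)//.
  rewrite ler_wpM2r ?powR_ge0// ger1_powR ?(ltW s1)//.
  by rewrite v0/= ler_pdivrMr// mul1r.
have -> : (x + y) `^ s = x / (x + y) * (x + y) `^ s + y / (x + y) * (x + y) `^ s.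
  by rewrite -mulrDl -mulrDl divff// mul1r.
by rewrite lerD// key// ?lerDl ?lerDr.
Qed.

Lemma powR_sum_le s n (x : nat -> R) : 0 < s < 1 -> (forall i, 0 <= x i) ->
  (\sum_(i < n) x i) `^ s <= \sum_(i < n) x i `^ s.
Proof.
move=> s01 x0; elim: n => [|n IHn].
  by rewrite !big_ord0 powR0// gt_eqF//; case/andP: s01.
rewrite !big_ord_recr/= (le_trans (powRD_le s01 _ (x0 n)))//.
  by rewrite sumr_ge0.
by rewrite lerD2r.
Qed.

Definition moment (P : set (Omega R) -> \bar R) s phi z (nu mu : site) : \bar R :=
  (\int[P]_w (normc (resolvent_entry w phi z mu nu) `^ s)%:E)%E.

Lemma measurable_normc_resolvent phi z mu nu : normc z != 1 ->
  measurable_fun setT (fun w : Omega R => normc (resolvent_entry w phi z mu nu)).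
Proof. by move=> z1; apply: measurable_normc; exact: cmeasurable_resolvent. Qed.

Lemma measurable_normc_det phi z mu :
  measurable_fun setT (fun w : Omega R => normc (plaquette_det w phi z mu)).
Proof.
apply: measurable_normc; rewrite /plaquette_det.
have mc := @cmeasurable_cst _ (Omega R) R.
apply: cmeasurableD; first exact: mc.
apply: cmeasurableN.
do 3!(apply: cmeasurableM; last exact: cmeasurable_coord).
by apply: cmeasurableM; [exact: mc|exact: cmeasurable_coord].
Qed.

(** [powRN_decoupling] applied to the phase at [mu] for each fixed choice of the others. Its
    constant 12 comes from [unif01_affine_sublevel], so [K] depends on [s] alone. *)
Lemma moment_decoupling s : 0 < s < 1 -> exists2 K : R, 0 < K &
  forall (P : probability (Omega R) R), is_product_uniform P ->
  forall phi z mu nu, normc z != 1 -> 0 < scale phi z ->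
  (moment P s phi z nu mu <= K%:E * \int[P]_w
    ((normc (plaquette_det w phi z mu) / scale phi z ^+ 4 *
      normc (resolvent_entry w phi z mu nu)) `^ s)%:E)%E.
Proof.
move=> s01; have [K K0 dec] := powRN_decoupling s01 (ltr0n R 12).
have s0 : 0 < s by case/andP: s01.
exists K => // P hP phi z mu nu z1 t0; rewrite /moment.
have t40 : 0 < scale phi z ^+ 4 by rewrite exprn_gt0.
pose f (w : Omega R) := normc (resolvent_entry w phi z mu nu).
pose q (w : Omega R) := normc (plaquette_det w phi z mu) / scale phi z ^+ 4.
have f0 w : 0 <= f w by exact: normc_ge0.
have q0 w : 0 <= q w by rewrite divr_ge0 ?normc_ge0// ltW.
have mf : measurable_fun setT f by exact: measurable_normc_resolvent.
have mq : measurable_fun setT q.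
  by apply: measurable_funM => //; exact: measurable_normc_det.
have mfs : measurable_fun setT (fun w => (f w `^ s)%:E).
  by apply/measurable_EFinP; exact: measurableT_comp (measurable_powR _) mf.
have mqfs : measurable_fun setT (fun w => ((q w * f w) `^ s)%:E).
  apply/measurable_EFinP; apply: measurableT_comp (measurable_powR _) _.
  exact: measurable_funM.
have mres := @measurable_resample R mu.
have mF (g : Omega R -> \bar R) : measurable_fun setT g -> (forall w, (0 <= g w)%E) ->
    measurable_fun setT (fun w => (\int[@unif01 R]_t g (resample mu (w, t)))%E).
  move=> mg g0.
  apply: (@measurable_fun_fubini_tonelli_F _ _ _ _ _ (@unif01 R) (g \o resample mu)).
    exact: measurableT_comp.
  by move=> x; exact: g0.
rewrite -[leLHS]/(\int[P]_w (f w `^ s)%:E)%E.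
rewrite -[X in (_ <= _ * X)%E]/(\int[P]_w ((q w * f w) `^ s)%:E)%E.
rewrite (integral_resample hP mu mfs); last by move=> w; rewrite lee_fin powR_ge0.
rewrite (integral_resample hP mu mqfs); last by move=> w; rewrite lee_fin powR_ge0.
rewrite -ge0_integralZl//; first last.
- by rewrite lee_fin ltW.
- by move=> w _; apply: integral_ge0 => t _; rewrite lee_fin powR_ge0.
- by apply: (mF _ mqfs) => w; rewrite lee_fin powR_ge0.
apply: ge0_le_integral => //.
- by move=> w _; apply: integral_ge0 => t _; rewrite lee_fin powR_ge0.
- by apply: (mF _ mfs) => w; rewrite lee_fin powR_ge0.
- apply: emeasurable_funM => //.
  by apply: (mF _ mqfs) => w; rewrite lee_fin powR_ge0.
move=> w _.
have [a [b [gamma fE]]] := resolvent_rank_one w phi mu nu z1.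
have [b' [nb' qE]] := plaquette_det_update w phi z mu.
pose M := Num.max (normc a) (normc b).
pose D t := normc (a + b * val (@circ R t)).
have D0 t : 0 < D t by have [] := fE (circ t).
have D2 t : D t <= 2 * M.
  rewrite (le_trans (normcD_le _ _))// Normc.normcM normc_circle mulr1.
  by rewrite mulr_natl mulr2n lerD// /M le_max lexx ?orbT.
have M0 : 0 < M by have := lt_le_trans (D0 0) (D2 0); rewrite pmulr_rgt0.
have fD t : f (resample mu (w, t)) = gamma / D t.
  by have [<- _] := fE (circ t); rewrite mulfK ?gt_eqF ?D0.
have g0 : 0 <= gamma.
  by have := f0 (resample mu (w, 0)); rewrite fD pmulr_lge0 ?invr_gt0.
(* If [gamma] vanishes, so does the entry for every phase; otherwise [gamma] supplies the positive
   lower bound on [dd]. *)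
have [g00|gn0] := eqVneq gamma 0.
  rewrite (_ : (\int[@unif01 R]_t _)%E = 0%E); last first.
    by apply: integral0_eq => t _; rewrite -/(f _) fD g00 mul0r powR0// gt_eqF.
  rewrite mule_ge0 ?lee_fin ?(ltW K0)//.
  by apply: integral_ge0 => t _; rewrite lee_fin powR_ge0.
have gp : 0 < gamma by rewrite lt_neqAle eq_sym gn0.
(* An upper bound on the entry is a lower bound on its denominator [D]. The added 1 makes division
   by [F] safe. *)
pose F := Num.sqrt (resolvent_bound z) + 1.
have F0 : 0 < F by rewrite ltr_wpDl ?sqrtr_ge0.
have fF w' : f w' <= F.
  have [l2G _ _] := resolvent_entryP w' phi nu z1.
  by rewrite (le_trans (l2le_normc mu l2G))// lerDl.
pose dd t := D t / M; pose qq t := q (resample mu (w, t)).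
have dd0 t : 0 < dd t by rewrite divr_gt0.
have mDc (a1 b1 : R[i]) :
    measurable_fun setT (fun t => normc (a1 + b1 * val (@circ R t))).
  apply: measurable_normc; apply: cmeasurableD; first exact: cmeasurable_cst.
  by apply: cmeasurableM; [exact: cmeasurable_cst|exact: cmeasurable_circ].
have mdd : measurable_fun setT dd by apply: measurable_funM => //; exact: mDc.
have qqE t : qq t = normc (z ^+ 4 + b' * val (@circ R t)) / scale phi z ^+ 4.
  by rewrite /qq /q -(qE (circ t)).
have mqq : measurable_fun setT qq.
  by rewrite (funext qqE); apply: measurable_funM => //; exact: mDc.
have maxE : Num.max (normc (z ^+ 4)) (normc b') = scale phi z ^+ 4.
  rewrite normcX nb' /scale.
  case: (leP (normc z) `|cos phi|) => h.
    by apply/max_idPr; rewrite lerXn2r ?nnegrE ?normc_ge0.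
  by apply/max_idPl; rewrite lerXn2r ?nnegrE ?normc_ge0// ltW.
have := dec _ _ (@unif01 R) dd qq (gamma / F / M) mdd mqq.
have -> : 0 < gamma / F / M by rewrite !divr_gt0.
move=> /(_ isT); have dd2 t : gamma / F / M <= dd t <= 2.
  apply/andP; split; last by rewrite /dd ler_pdivrMr// D2.
  rewrite /dd ler_pM2r ?invr_gt0// ler_pdivrMr// mulrC -ler_pdivrMr ?D0//.
  by rewrite -fD fF.
move=> /(_ dd2 (fun t => q0 _)).
have sub1 r : 0 <= r -> (unif01 [set t | (dd t < r)%R] <= (12 * r)%:E)%E.
  move=> r0; have := unif01_affine_sublevel a b r0.
  by congr (_ <= _)%E; congr unif01; apply/seteqP; split => t /=;
    rewrite /dd ltr_pdivrMr.
have sub2 r : 0 <= r -> (unif01 [set t | (qq t < r)%R] <= (12 * r)%:E)%E.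
  move=> r0; have := unif01_affine_sublevel (z ^+ 4) b' r0; rewrite maxE.
  by congr (_ <= _)%E; congr unif01; apply/seteqP; split => t /=;
    rewrite qqE ltr_pdivrMr.
move=> /(_ sub1 sub2) main.
have gM : 0 <= gamma / M by rewrite divr_ge0// ltW.
have fdd t : f (resample mu (w, t)) `^ s = (gamma / M) `^ s * dd t `^ (- s).
  have -> : gamma / M = f (resample mu (w, t)) * dd t.
    by rewrite fD /dd mulrA divfK// gt_eqF.
  by rewrite powRM ?f0 ?(ltW (dd0 t))// powRN mulfK// gt_eqF// powR_gt0.
have mdds : measurable_fun setT (fun t => (dd t `^ (- s))%:E).
  by apply/measurable_EFinP; exact: measurableT_comp (measurable_powR _) mdd.
have mqdds : measurable_fun setT (fun t => (qq t `^ s * dd t `^ (- s))%:E).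
  apply/measurable_EFinP; apply: measurable_funM; last exact/measurable_EFinP.
  exact: measurableT_comp (measurable_powR _) mqq.
have e1 : (\int[@unif01 R]_t (f (resample mu (w, t)) `^ s)%:E =
    ((gamma / M) `^ s)%:E * \int[@unif01 R]_t (dd t `^ (- s))%:E)%E.
  rewrite -ge0_integralZl//; last 2 first.
  - by move=> t _; rewrite lee_fin powR_ge0.
  - by rewrite lee_fin powR_ge0.
  by apply: eq_integral => t _; rewrite fdd EFinM.
have e2 : (\int[@unif01 R]_t ((q (resample mu (w, t)) * f (resample mu (w, t))) `^ s)%:E =
    ((gamma / M) `^ s)%:E * \int[@unif01 R]_t (qq t `^ s * dd t `^ (- s))%:E)%E.
  rewrite -ge0_integralZl//; last 2 first.
  - by move=> t _; rewrite lee_fin mulr_ge0 ?powR_ge0.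
  - by rewrite lee_fin powR_ge0.
  apply: eq_integral => t _; rewrite -/(qq t) powRM ?q0 ?f0// fdd -EFinM.
  by congr EFin; rewrite mulrCA.
by rewrite e1 e2 muleCA lee_wpmul2l ?lee_fin ?powR_ge0.
Qed.

Lemma moment_recursion s : 0 < s < 1 -> exists2 K : R, 0 < K &
  forall (P : probability (Omega R) R), is_product_uniform P ->
  forall phi z mu nu, normc z != 1 -> 2^-1 <= `|cos phi| ->
  (moment P s phi z nu mu <=
   \sum_(j < 4) (K * `|sin phi| `^ s)%:E * moment P s phi z nu (step j mu) +
   (K * \sum_(j < 4) (iter j sigL_inv mu == nu)%:R)%:E)%E.
Proof.
move=> s01; have [K K0 dec] := moment_decoupling s01.
have s0 : 0 < s by case/andP: s01.
have s1 : s <= 1 by case/andP: s01 => _ /ltW.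
exists (2 * K); first by rewrite mulr_gt0.
move=> P hP phi z mu nu z1 c1; set t := scale phi z.
have t1 : 2^-1 <= t by rewrite (le_trans c1)// /t /scale le_max lexx orbT.
have t0 : 0 < t by rewrite (lt_le_trans _ t1)// invr_gt0.
pose h j (w : Omega R) := normc (resolvent_entry w phi z (step j mu) nu).
pose e j : R := (iter j sigL_inv mu == nu)%:R.
have e0 j : 0 <= e j by rewrite /e ler0n.
have h0 j w : 0 <= h j w by exact: normc_ge0.
have point (w : Omega R) : (normc (plaquette_det w phi z mu) / t ^+ 4 *
    normc (resolvent_entry w phi z mu nu)) `^ s <=
    \sum_(j < 4) (2 * `|sin phi| `^ s) * h j w `^ s + 2 * \sum_(j < 4) e j.
  have x0 j : 0 <= `|sin phi| * h j w + e j by rewrite addr_ge0 ?mulr_ge0.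
  have S0 : 0 <= \sum_(j < 4) (`|sin phi| * h j w + e j) by rewrite sumr_ge0.
  (* The factor 2 bounds t^3 / t^4 = 1 / t, since t is at least |cos phi| and hence at least 1/2;
     this covers small |z| as well. *)
  apply: (@le_trans _ _ ((2 * \sum_(j < 4) (`|sin phi| * h j w + e j)) `^ s)).
    rewrite ge0_ler_powR ?nnegrE ?(ltW s0)//.
    - by rewrite mulr_ge0 ?normc_ge0// divr_ge0 ?normc_ge0// exprn_ge0// ltW.
    - by rewrite mulr_ge0.
    rewrite mulrAC ler_pdivrMr ?exprn_gt0//.
    apply: (le_trans (plaquette_bound w phi mu nu z1)).
    rewrite -/t [leRHS]mulrAC ler_wpM2r// (exprS t 3) mulrA.
    by rewrite ler_peMl ?exprn_ge0 ?(ltW t0)//; lra.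
  rewrite powRM//.
  have -> : \sum_(j < 4) (2 * `|sin phi| `^ s) * h j w `^ s + 2 * \sum_(j < 4) e j =
      2 * \sum_(j < 4) (`|sin phi| `^ s * h j w `^ s + e j).
    by rewrite big_split/= mulrDr !mulr_sumr; congr (_ + _);
      apply: eq_bigr => j _; rewrite mulrA.
  apply: ler_pM; rewrite ?powR_ge0// ?ler1_powR// ?ler1n//.
  apply: (le_trans (powR_sum_le 4 s01 x0)); apply: ler_sum => j _.
  apply: (le_trans (powRD_le s01 _ (e0 j))); first exact: mulr_ge0.
  rewrite powRM// lerD2l /e; case: (_ == _); first by rewrite powR1.
  by rewrite powR0// gt_eqF.
have mh j : measurable_fun setT (fun w => h j w `^ s).
  apply: (measurableT_comp (measurable_powR _)).
  exact: measurable_normc_resolvent.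
have cj0 : 0 <= 2 * `|sin phi| `^ s by rewrite mulr_ge0 ?powR_ge0.
apply: (le_trans (dec P hP phi z mu nu z1 t0)).
pose g w := \sum_(j < 4) (2 * `|sin phi| `^ s) * h j w `^ s.
have mg : measurable_fun setT g.
  by apply: measurable_sum => j; exact: measurable_funM.
have g0 w : 0 <= g w by rewrite sumr_ge0// => j _; rewrite mulr_ge0 ?powR_ge0.
have E0 : 0 <= 2 * \sum_(j < 4) e j by rewrite mulr_ge0 ?sumr_ge0.
apply: (@le_trans _ _ (K%:E * \int[P]_w ((g w)%:E + (2 * \sum_(j < 4) e j)%:E))%E).
  rewrite lee_wpmul2l ?lee_fin ?(ltW K0)//; apply: ge0_le_integral => //.
  - by move=> w _; rewrite lee_fin powR_ge0.
  - apply/measurable_EFinP; apply: (measurableT_comp (measurable_powR _)).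
    apply: measurable_funM; last exact: measurable_normc_resolvent.
    by apply: measurable_funM => //; exact: measurable_normc_det.
  - by apply: emeasurable_funD => //; exact/measurable_EFinP.
  - by move=> w _; rewrite -EFinD lee_fin; exact: point.
have -> : (\int[P]_w ((g w)%:E + (2 * \sum_(j < 4) e j)%:E) =
    \int[P]_w (g w)%:E + \int[P]_w (2 * \sum_(j < 4) e j)%:E)%E.
  apply: ge0_integralD => //.
  - by move=> w _; rewrite lee_fin.
  - exact/measurable_EFinP.
rewrite [X in (_ * (_ + X))%E](_ : _ = (2 * \sum_(j < 4) e j)%:E); last first.
  by rewrite integral_cst// -[RHS]mule1 -(probability_setT P).
rewrite (_ : (\int[P]_w (g w)%:E)%E = (\sum_(j < 4) (2 * `|sin phi| `^ s)%:E *
    moment P s phi z nu (step j mu))%E); last first.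
  apply: (@ge0_integral_combination _ _ _ P _ _ (fun=> 2 * `|sin phi| `^ s)
    (fun (j : 'I_4) w => h j w `^ s)) => //.
  by move=> j w; exact: powR_ge0.
have m0 j : (0 <= moment P s phi z nu (step j mu))%E.
  by apply: integral_ge0 => w _; rewrite lee_fin powR_ge0.
rewrite ge0_muleDr ?lee_fin//; last first.
  by apply: sume_ge0 => j _; rewrite mule_ge0.
rewrite ge0_sume_distrr => [|j _]; last by rewrite mule_ge0.
apply: leeD; last by rewrite -EFinM lee_fin mulrA (mulrC K).
by apply: lee_sum => j _; rewrite muleA -EFinM mulrA (mulrC K).
Qed.

End fractional_moments.
(** * Exponential decay *)

(** The exponential [E] is a supersolution. A hop of length at most 4 costs a factor e^4, so the
    four neighbours together yield at most E / 2; and the source is at most E / 2, because it lives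
    within distance 3 and [B] contains 2 K e^3. The excess over [E] is halved at each iteration, so
    [M] disappears from the conclusion. *)
Lemma exponential_decay (R : realType) (a : site -> R) (nu : site)
    (h : nat -> site -> site) (kappa K M : R) :
  0 <= kappa -> kappa * (4 * expR 4) <= 2^-1 -> 0 <= K ->
  (forall mu, a mu <= M) ->
  (forall j mu, (j < 4)%N -> (l1dist mu (h j mu) <= 4)%N) ->
  (forall mu, a mu <= \sum_(j < 4) kappa * a (h j mu) +
                      K * (l1dist mu nu <= 3)%N%:R) ->
  forall mu, a mu <= 2 * K * expR 3 * expR (- (l1dist mu nu)%:R).
Proof.
move=> k0 k1 K0 aM hd arec.
pose B := 2 * K * expR 3; pose E mu := B * expR (- (l1dist mu nu)%:R).
have B0 : 0 <= B by rewrite !mulr_ge0 ?expR_ge0.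
have k4 : kappa * 4 <= 2^-1.
  apply: le_trans k1; rewrite mulrA ler_peMr ?mulr_ge0//.
  by rewrite -expR0 ler_expR.
have bound n mu : a mu <= E mu + `|M| * 2^-1 ^+ n.
  elim: n mu => [|n IHn] mu.
    rewrite expr0 mulr1 (le_trans (aM mu))// (le_trans (ler_norm M))// lerDr.
    by rewrite mulr_ge0 ?expR_ge0.
  have Eh (j : 'I_4) : E (h j mu) <= expR 4 * E mu.
    rewrite /E mulrCA ler_wpM2l// -expRD ler_expR.
    have := l1dist_triangle mu (h j mu) nu; have := hd j mu (ltn_ord j).
    move=> d1 d2; rewrite lerBrDr addrC lerBlDr -(natrD R 4) ler_nat.
    by rewrite (leq_trans d2)// leq_add2r.
  apply: (le_trans (arec mu)).
  have step1 : \sum_(j < 4) kappa * a (h j mu) <=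
      2^-1 * E mu + 2^-1 * (`|M| * 2^-1 ^+ n).
    apply: (@le_trans _ _ (\sum_(j < 4) kappa *
        (expR 4 * E mu + `|M| * 2^-1 ^+ n))).
      apply: ler_sum => j _; rewrite ler_wpM2l// (le_trans (IHn _))//.
      by rewrite lerD2r.
    rewrite sumr_const card_ord -(mulr_natr (kappa * _)).
    have E0 : 0 <= E mu by rewrite mulr_ge0 ?expR_ge0.
    have Y0 : 0 <= `|M| * 2^-1 ^+ n by rewrite mulr_ge0 ?exprn_ge0.
    move: (E mu) E0 (`|M| * _) Y0 (expR 4) k1 => X X0 Y Y0 e k1'.
    have := ler_wpM2r X0 k1'; have := ler_wpM2r Y0 k4.
    have -> : kappa * (e * X + Y) * 4 = kappa * (4 * e) * X + kappa * 4 * Y by ring.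
    by lra.
  have step2 : K * (l1dist mu nu <= 3)%N%:R <= 2^-1 * E mu.
    case: (leqP (l1dist mu nu) 3) => d; last first.
      by rewrite mulr0 mulr_ge0// mulr_ge0 ?expR_ge0.
    rewrite mulr1 /E /B -!mulrA mulKf// -expRD ler_peMr//.
    by rewrite -[leLHS]expR0 ler_expR subr_ge0 ler_nat.
  by rewrite exprS; lra.
move=> mu; apply/ler_addgt0Pr => eps eps0.
have [n nP] : exists n, `|M| * 2^-1 ^+ n <= eps.
  exists (Num.Def.archi_bound (`|M| / eps)).
  rewrite exprVn ler_pdivrMr ?exprn_gt0// mulrC -ler_pdivrMr//.
  by rewrite ltW// upper_nthrootP.
by rewrite (le_trans (bound n mu))// lerD2l.
Qed.

Lemma l1dist_iter_sigL_inv j (mu : site) : (l1dist mu (iter j sigL_inv mu) <= j)%N.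
Proof.
elim: j => [|j IHj] /=; first by rewrite l1dist0.
apply: leq_trans (l1dist_triangle _ (iter j sigL_inv mu) _) _.
by rewrite -[leqRHS]addn1 leq_add// l1dist_sigL_inv.
Qed.

Lemma l1dist_step j (mu : site) : (l1dist mu (step j mu) <= j.+1)%N.
Proof.
apply: leq_trans (l1dist_triangle _ (iter j sigL_inv mu) _) _.
by rewrite -[leqRHS]addn1 leq_add ?l1dist_iter_sigL_inv// l1dist_sigR_inv.
Qed.

Lemma moment_le (R : realType) (P : probability (Omega R) R) (s phi : R)
    (z : R[i]) (nu mu : site) : 0 <= s -> Normc.normc z != 1 ->
  (0 <= moment P s phi z nu mu <= (Num.sqrt (resolvent_bound z) `^ s)%:E)%E.
Proof.
move=> s0 z1; apply/andP; split.
  by apply: integral_ge0 => w _; rewrite lee_fin powR_ge0.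
rewrite -[leRHS]mule1 -(probability_setT P) -integral_cst//.
apply: ge0_le_integral => //.
- by move=> w _; rewrite lee_fin powR_ge0.
- apply/measurable_EFinP; apply: (measurableT_comp (measurable_powR _)).
  exact: measurable_normc_resolvent.
- move=> w _; rewrite lee_fin ge0_ler_powR ?nnegrE ?normc_ge0 ?sqrtr_ge0//.
  by have [l2G _ _] := resolvent_entryP w phi nu z1; exact: l2le_normc l2G.
Qed.

Unset Implicit Arguments.

Theorem theorem3 (R : realType) (s : R) (hs : 0 < s < 1)
  (P : probability (Omega R) R) (hP : is_product_uniform P) :
  exists phi0 c g : R, [/\ 0 < phi0, 0 < c, 0 < g &
    forall (phi : R), `|phi| <= phi0 ->
    forall (mu nu : site) (z : R[i]), Normc.normc z != 1 ->
      (\int[P]_w ((Normc.normc (resolvent_entry w phi z mu nu)) `^ s)%:E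
         <= (c * expR (- g * dist2 mu nu))%:E)%E].
Proof.
have [K K0 rec] := moment_recursion hs.
have s0 : 0 < s by case/andP: hs.
(* The largest value of |sin phi|^s for which K |sin phi|^s 4 e^4 is at most 1/2. *)
pose k0 := (8 * K * expR 4)^-1.
have k00 : 0 < k0 by rewrite invr_gt0 !mulr_gt0 ?expR_gt0.
(* The bound 1/2 keeps |cos phi| above 1/2, as cos^2 = 1 - sin^2 is at least 3/4; the other bound
   gives |sin phi|^s <= [k0]. *)
pose phi0 := Num.min 2^-1 (k0 `^ s^-1).
(* The rate is fixed at 1 and [phi0] is adapted to it. The 4 counts the source terms around the
   cycle. *)
exists phi0, (2 * (K * 4) * expR 3), 1; split=> //.
- by rewrite lt_min invr_gt0 ltr0n powR_gt0.
- by rewrite !mulr_gt0 ?expR_gt0.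
move=> phi; rewrite le_min => /andP[phi2 phik] mu nu z z1.
have sphi : `|sin phi| <= `|phi| by exact: normr_sin_le.
have cphi : 2^-1 <= `|cos phi|.
  rewrite -(ler_pXn2r (n := 2)) ?nnegrE// real_normK ?num_real// cos2sin2.
  rewrite -(real_normK (num_real (sin phi))).
  have := normr_ge0 (sin phi); nra.
have kap0 : 0 <= K * `|sin phi| `^ s by rewrite mulr_ge0 ?powR_ge0// ltW.
have kap1 : K * `|sin phi| `^ s * (4 * expR 4) <= 2^-1.
  have : `|sin phi| `^ s <= k0.
    have -> : k0 = (k0 `^ s^-1) `^ s by rewrite -powRrM mulVf ?gt_eqF// powRr1// ltW.
    by rewrite ge0_ler_powR ?nnegrE ?powR_ge0 ?(ltW s0)// (le_trans sphi).
  move=> h; rewrite mulrAC -ler_pdivlMl ?mulr_gt0 ?expR_gt0//.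
  rewrite (le_trans h)// /k0 le_eqVlt; apply/orP; left; apply/eqP.
  by field; rewrite !gt_eqF ?expR_gt0.
(* The moments are finite by the deterministic bound, so the recursion can be read in the reals. *)
pose a m := fine (moment P s phi z nu m).
have mb m := moment_le P phi nu m (ltW s0) z1.
have aE m : (a m)%:E = moment P s phi z nu m.
  rewrite /a fineK// ge0_fin_numE; last by case/andP: (mb m).
  by case/andP: (mb m) => _ /le_lt_trans; apply; exact: ltry.
have decay := @exponential_decay R a nu step _ (K * 4)
  (Num.sqrt (resolvent_bound z) `^ s) kap0 kap1.
rewrite -/(moment P s phi z nu mu) -aE lee_fin.
apply: (@le_trans _ _ (2 * (K * 4) * expR 3 * expR (- (l1dist mu nu)%:R))).
  apply: decay => [|m|j m j4|m].
  - by rewrite mulr_ge0 ?(ltW K0).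
  - by rewrite -lee_fin aE; case/andP: (mb m).
  - by rewrite (leq_trans (l1dist_step j m)).
  have := rec P hP phi z m nu z1 cphi.
  under eq_bigr do rewrite -aE -EFinM.
  rewrite sumEFin -aE -EFinD lee_fin => /le_trans; apply.
  rewrite lerD2l -mulrA ler_wpM2l ?(ltW K0)//.
  (* The sites of the cycle are reached by at most three hops, so no source term survives beyond
     distance 3. *)
  case: (leqP (l1dist m nu) 3) => d.
    apply: (@le_trans _ _ (\sum_(j < 4) 1)); last by rewrite sumr_const card_ord mulr1.
    by apply: ler_sum => j _; rewrite lern1 leq_b1.
  rewrite mulr0 big1// => j _; case: eqP => // mnu; move: d; rewrite -mnu.
  rewrite ltnNge (leq_trans (l1dist_iter_sigL_inv j m))//.
  by rewrite -ltnS ltn_ord.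
rewrite ler_wpM2l ?mulr_ge0 ?expR_ge0 ?(ltW K0)//.
by rewrite ler_expR mulN1r lerN2 dist2_le_l1dist.
Qed.
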